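(* Let $a_1,a_2\in\mathbb{Q}$ with $0<a_1,a_2<1$. The mirror map $q(a_1,a_2|z)$ is $N$-integral if and only if the unordered pair $\{a_1,a_2\}$ (with multiplicity) is one of the following 28 pairs: $(\frac12,\frac12)$, $(\frac23,\frac13)$, $(\frac34,\frac14)$, $(\frac56,\frac16)$, $(\frac16,\frac16)$, $(\frac13,\frac16)$, $(\frac12,\frac16)$, $(\frac13,\frac13)$, $(\frac23,\frac23)$, $(\frac14,\frac14)$, $(\frac12,\frac14)$, $(\frac34,\frac12)$, $(\frac34,\frac34)$, $(\frac12,\frac13)$, $(\frac23,\frac16)$, $(\frac23,\frac12)$, $(\frac56,\frac13)$, $(\frac56,\frac12)$, $(\frac56,\frac23)$, $(\frac56,\frac56)$, $(\frac38,\frac18)$, $(\frac58,\frac18)$, $(\frac78,\frac38)$, $(\frac78,\frac58)$, $(\frac5{12},\frac1{12})$, $(\frac7{12},\frac1{12})$, $(\frac{11}{12},\frac5{12})$, $(\frac{11}{12},\frac7{12})$.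
   Context: For $a=(a_1,a_2)$ put $(x)_k=x(x+1)\cdots(x+k-1)$, $(x)_0=1$, and define the formal power series $$F(a|z)=\sum_{k=0}^\infty \frac{(a_1)_k(a_2)_k}{k!^2}z^k,\qquad G(a|z)=\sum_{k=1}^\infty \frac{(a_1)_k(a_2)_k}{k!^2}\Big[\sum_{j=1}^2\sum_{i=0}^{k-1}\Big(\frac1{a_j+i}-\frac1{1+i}\Big)\Big]z^k .$$ The mirror map is $q(a|z)=z\exp\big(G(a|z)/F(a|z)\big)\in\mathbb{Q}[[z]]$. It is called $N$-integral if there exists a natural number $N\ge1$ such that $q(a|Nz)$ has integer coefficients. *)

(* Defs.v *)
From mathcomp Require Import all_boot all_order all_algebra.

Set Implicit Arguments.
Unset Strict Implicit.
Unset Printing Implicit Defensive.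

Import Order.TTheory GRing.Theory Num.Theory.
Local Open Scope ring_scope.

(* Elements of Q[[z]], as coefficient sequences: f n is the coefficient of z^n. *)
Definition fps := nat -> rat.

Definition fps_one : fps := fun n => (n == 0%N)%:R.

Definition fps_mul (f g : fps) : fps :=
  fun n => \sum_(i < n.+1) f i * g (n - i)%N.

Definition fps_pow (f : fps) (k : nat) : fps := iter k (fps_mul f) fps_one.

(* The first n coefficients of 1/f, obtained by solving f * g = 1 for
   g_0, g_1, ...; meaningful when f 0 != 0 (see fps_mulfV). *)
Fixpoint fps_inv_seq (f : fps) (n : nat) : seq rat :=
  if n is m.+1 then
    let s := fps_inv_seq f m in
    rcons s ((f 0%N)^-1 * (fps_one m - \sum_(i < m) s`_i * f (m - i)%N))
  else [::].

Definition fps_inv (f : fps) : fps := fun n => (fps_inv_seq f n.+1)`_n.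

Definition fps_div (f g : fps) : fps := fps_mul f (fps_inv g).

(* exp(h) = \sum_k h^k / k!, for h 0 = 0: the coefficient of z^n in h^k then
   vanishes for k > n (see fps_pow_eq0), so that the sum stops at k = n. *)
Definition fps_exp (h : fps) : fps :=
  fun n => \sum_(k < n.+1) fps_pow h k n / (k`!)%:R.

Definition fps_mulz (f : fps) : fps := fun n => if n is m.+1 then f m else 0.

(* f(c z) *)
Definition fps_scale (c : rat) (f : fps) : fps := fun n => f n * c ^+ n.

Definition fps_integral (f : fps) : Prop := forall n, f n \is a Num.int.

Definition rising (x : rat) (k : nat) : rat := \prod_(i < k) (x + i%:R).

Definition Fseries (a1 a2 : rat) : fps :=
  fun k => rising a1 k * rising a2 k / (k`!)%:R ^+ 2.

(* The bracket is an empty sum for k = 0, so the series starts at k = 1. *)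
Definition Gseries (a1 a2 : rat) : fps :=
  fun k => rising a1 k * rising a2 k / (k`!)%:R ^+ 2 *
    (\sum_(i < k) (1 / (a1 + i%:R) - 1 / (1 + i%:R)) +
     \sum_(i < k) (1 / (a2 + i%:R) - 1 / (1 + i%:R))).

Definition mirror_map (a1 a2 : rat) : fps :=
  fps_mulz (fps_exp (fps_div (Gseries a1 a2) (Fseries a1 a2))).

Definition N_integral (f : fps) : Prop :=
  exists N : nat, (1 <= N)%N /\ fps_integral (fps_scale N%:R f).

Definition mirror_pairs : seq (rat * rat) :=
  [:: (1/2, 1/2); (2/3, 1/3); (3/4, 1/4); (5/6, 1/6);
      (1/6, 1/6); (1/3, 1/6); (1/2, 1/6); (1/3, 1/3); (2/3, 2/3);
      (1/4, 1/4); (1/2, 1/4); (3/4, 1/2); (3/4, 3/4);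
      (1/2, 1/3); (2/3, 1/6); (2/3, 1/2); (5/6, 1/3); (5/6, 1/2);
      (5/6, 2/3); (5/6, 5/6); (3/8, 1/8); (5/8, 1/8);
      (7/8, 3/8); (7/8, 5/8); (5/12, 1/12); (7/12, 1/12);
      (11/12, 5/12); (11/12, 7/12)].

Lemma size_fps_inv_seq f n : size (fps_inv_seq f n) = n.
Proof. by elim: n => //= n IHn; rewrite size_rcons IHn. Qed.

Lemma nth_fps_inv_seq f n i : (i < n)%N -> (fps_inv_seq f n)`_i = fps_inv f i.
Proof.
elim: n => // n IHn; rewrite ltnS leq_eqVlt => /orP[/eqP-> // | lt_in] /=.
by rewrite nth_rcons size_fps_inv_seq lt_in IHn.
Qed.

Lemma fps_mulC f g : fps_mul f g =1 fps_mul g f.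
Proof.
move=> n; rewrite /fps_mul (reindex_inj rev_ord_inj) /=.
by apply: eq_bigr => i _; rewrite subSS mulrC subKn // -ltnS.
Qed.

Lemma fps_mulfV f : f 0%N != 0 -> fps_mul f (fps_inv f) =1 fps_one.
Proof.
move=> f0 n; rewrite fps_mulC /fps_mul big_ord_recr /= subnn.
rewrite {2}/fps_inv /= nth_rcons size_fps_inv_seq ltnn eqxx.
rewrite mulrAC mulVf // mul1r addrC.
under [X in _ - X]eq_bigr => i _ do rewrite nth_fps_inv_seq //.
exact: subrK.
Qed.

Lemma fps_pow_eq0 h k n : h 0%N = 0 -> (n < k)%N -> fps_pow h k n = 0.
Proof.
move=> h0; elim: k n => // k IHk n lt_nk; rewrite /fps_pow iterS /fps_mul.
rewrite big_ord_recl h0 mul0r add0r big1 // => i _.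
rewrite -/(fps_pow h k) IHk ?mulr0 //= /bump leq0n.
by have := ltn_ord i; case: n lt_nk i => [|n] lt_nk i //; rewrite add1n subSS => _;
  apply: leq_ltn_trans (leq_subr _ _) _.
Qed.

(* Main.v *)
Require Import Defs.
From HB Require Import structures.
From mathcomp Require Import all_boot all_order all_algebra.
From mathcomp Require Import boolp.
From mathcomp Require Import ring lra zify.

(** Write w = G / F, so that q = z exp w, and let p be a prime not dividing the
    denominators of a1 and a2.  Two congruences link w with p-integrality.

    Dwork's congruence ([dwork_congruence]): if a' denotes the rational
    (a + t) / p with 0 <= t < p and a + t divisible by p, then
    w(a1', a2' | z^p) - p w(a1, a2 | z) has coefficients divisible by p.  After
    multiplication by F(a | z) F(a' | z^p) it becomes a statement on
    convolution sums.  The coefficient A(k) of F satisfies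
    A(v + p n) = A'(n) Phi_v(n), where Phi_v is p-integral and
    Phi_v(x) - Phi_v(y) is divisible by p (x - y) ([frob_ratio_lip]), and the
    sums are antisymmetric in Phi_v.  They are bounded by a single induction
    ([Gseries_lip_sum]): splitting off the last base p digit turns such a sum
    for a into sums of the same shape for a', which are p times shorter.

    The Dieudonne-Dwork criterion ([dieudonne_dwork] and its converse): exp w
    is p-integral if and only if w(z^p) - p w(z) is divisible by p.

    Together they show that exp w(a) is p-integral exactly when
    w(a') = w(a) modulo p.  Any finite set of primes can be ignored, because
    exp w converges p-adically near 0 and z can be rescaled
    ([exp_Gratio_scale_upto]).

    If q is N-integral, then w(a') and w(a) agree modulo every large p; their
    first two coefficients have bounded height, hence are equal, and these two
    coefficients determine the pair up to order and up to a -> 1 - a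
    ([coef_determines]).  As p a' = a modulo Z, multiplication by every large
    prime preserves the pair modulo Z up to order and a common sign.  By
    multiplicativity and the Chinese remainder theorem the same holds for every
    u prime to the common denominator d.  Then u^2 = 1 modulo d for all such u,
    so d divides 24 ([dvdn24_sqr]), and the pairs with denominator 24 are
    enumerated ([signed_stable24_mirror]).

    Conversely a pair of the table is stable under all primes p > 24, so
    {a1', a2'} is {a1, a2} or {1 - a1, 1 - a2}.  In the second case
    w(a') = w(a) as well ([Gratio_compl]): the Wronskian relation
    1 + z dw/dz = 1 / y^2 holds for y = F (1 - z)^((a1 + a2) / 2), and the
    differential equation of y is invariant under a -> 1 - a. *)

Set Implicit Arguments.
Unset Strict Implicit.
Unset Printing Implicit Defensive.
Import Order.TTheory GRing.Theory Num.Theory.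
Local Open Scope ring_scope.

(** * The ring of power series over the rationals *)

Lemma fpsP (f g : fps) : (forall n, f n = g n) -> f = g.
Proof. exact: functional_extensionality_dep. Qed.

HB.instance Definition _ := gen_eqMixin fps.
HB.instance Definition _ := gen_choiceMixin fps.

Definition fps_add (f g : fps) : fps := fun n => f n + g n.
Definition fps_opp (f : fps) : fps := fun n => - f n.

Fact fps_addA : associative fps_add.
Proof. by move=> f g h; apply: fpsP => n; exact: addrA. Qed.
Fact fps_addC : commutative fps_add.
Proof. by move=> f g; apply: fpsP => n; exact: addrC. Qed.
Fact fps_add0 : left_id (fun=> 0 : rat) fps_add.
Proof. by move=> f; apply: fpsP => n; exact: add0r. Qed.
Fact fps_addN : left_inverse (fun=> 0 : rat) fps_opp fps_add.
Proof. by move=> f; apply: fpsP => n; exact: addNr. Qed.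

HB.instance Definition _ :=
  GRing.isZmodule.Build fps fps_addA fps_addC fps_add0 fps_addN.

Fact fps_mul_comm : commutative fps_mul.
Proof. by move=> f g; apply: fpsP => n; exact: fps_mulC. Qed.

Fact fps_mul1 : left_id fps_one fps_mul.
Proof.
move=> f; apply: fpsP => n; rewrite /fps_mul big_ord_recl /fps_one eqxx mul1r subn0.
by rewrite big1 ?addr0 // => i _; rewrite lift0 mul0r.
Qed.

Fact fps_mulD : left_distributive fps_mul fps_add.
Proof.
move=> f g h; apply: fpsP => n; rewrite /fps_mul /fps_add -big_split.
by apply: eq_bigr => i _; rewrite mulrDl.
Qed.

(** Both sides are the sum of f i * g j * h k over i + j + k = n; [F] extends the
    summand by zero to the square of all i and k at most n. *)
Fact fps_mulA : associative fps_mul.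
Proof.
move=> f g h; apply: fpsP => n; rewrite [RHS]fps_mulC /fps_mul.
pose F i k := if (i + k <= n)%N then f i * g (n - k - i)%N * h k else 0.
transitivity (\sum_(i < n.+1) \sum_(k < n.+1) F i k).
  apply: eq_bigr => i _; rewrite -[X in _ * X]/(fps_mul g h (n - i)%N) fps_mulC.
  rewrite /fps_mul mulr_sumr (big_ord_widen n.+1 (fun k =>
    f i * (h k * g (n - i - k)%N))) ?ltnS ?leq_subr // big_mkcond.
  apply: eq_bigr => k _; rewrite /F.
  have -> : (k < (n - i).+1)%N = (i + k <= n)%N by have := ltn_ord i; lia.
  by case: ifP => // _; rewrite (_ : n - i - k = n - k - i)%N; [ring | lia].
rewrite exchange_big; apply: eq_bigr => k _; rewrite mulr_sumr.
rewrite (big_ord_widen n.+1 (fun i => h k * (f i * g (n - k - i)%N)));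
  last by rewrite ltnS leq_subr.
rewrite [RHS]big_mkcond; apply: eq_bigr => i _; rewrite /F.
have -> : (i < (n - k).+1)%N = (i + k <= n)%N by have := ltn_ord k; lia.
by case: ifP => // _; ring.
Qed.

Fact fps_one_neq0 : (fps_one : fps) != 0.
Proof. by apply/eqP => /(congr1 (fun f : fps => f 0%N)) /eqP; rewrite oner_eq0. Qed.

HB.instance Definition _ :=
  GRing.Zmodule_isComNzRing.Build fps fps_mulA fps_mul_comm fps_mul1 fps_mulD fps_one_neq0.

Lemma fps_coef0 n : (0 : fps) n = 0. Proof. by []. Qed.
Lemma fps_coef1 n : (1 : fps) n = (n == 0%N)%:R. Proof. by []. Qed.
Lemma fps_coefD (f g : fps) n : (f + g) n = f n + g n. Proof. by []. Qed.
Lemma fps_coefN (f : fps) n : (- f) n = - f n. Proof. by []. Qed.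
Lemma fps_coefM (f g : fps) n : (f * g) n = \sum_(i < n.+1) f i * g (n - i)%N.
Proof. by []. Qed.
Lemma fps_powE (f : fps) k : fps_pow f k = f ^+ k.
Proof. by elim: k => // k IH; rewrite exprS -IH. Qed.

(** * Rationals integral at p *)

(** Coprimality of the denominator with [p] gives a subring for every natural
    number [p]; the instance below could not carry a primality hypothesis. *)
Definition Zloc (p : nat) : {pred rat} := fun x => coprime p `|denq x|.

Lemma ZlocP p x :
  reflect (exists2 n : nat, coprime p n & x * n%:R \is a Num.int) (x \in Zloc p).
Proof.
have Ndenq : (`|denq x|%N)%:R = (denq x)%:~R :> rat.
  by rewrite -[in RHS](gez0_abs (ltW (denq_gt0 x))).
apply: (iffP idP) => [px | [n cpn /intrP[z xn]]].
  by exists `|denq x|%N; rewrite // Ndenq -numqE intr_int.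
rewrite unfold_in; apply: coprime_dvdr cpn.
have /eqP : (numq x * n)%:~R = (z * denq x)%:~R :> rat.
  by rewrite !rmorphM /= -xn numqE; ring.
rewrite eqr_int => /eqP /(congr1 absz); rewrite !abszM => e.
rewrite -(@Gauss_dvdr _ `|numq x|%N) ?e ?dvdn_mull //.
by rewrite coprime_sym coprime_num_den.
Qed.

Fact Zloc_subring p : subring_closed (Zloc p).
Proof.
split.
- by apply/ZlocP; exists 1%N; rewrite ?coprimen1 // mulr1 rpred1.
- move=> x y /ZlocP[m cm xm] /ZlocP[n cn yn]; apply/ZlocP; exists (m * n)%N.
    by rewrite coprimeMr cm.
  have -> : (x - y) * (m * n)%:R = (x * m%:R) * n%:R - (y * n%:R) * m%:R.
    by rewrite natrM; ring.
  by apply: rpredB; apply: rpredM => //; apply: natr_int.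
- move=> x y /ZlocP[m cm xm] /ZlocP[n cn yn]; apply/ZlocP; exists (m * n)%N.
    by rewrite coprimeMr cm.
  have -> : x * y * (m * n)%:R = (x * m%:R) * (y * n%:R) by rewrite natrM; ring.
  by rewrite rpredM.
Qed.
HB.instance Definition _ p :=
  GRing.isSubringClosed.Build rat (Zloc p) (Zloc_subring p).

Lemma Zloc_int p x : x \is a Num.int -> x \in Zloc p.
Proof. by move=> xi; apply/ZlocP; exists 1%N; rewrite ?coprimen1 ?mulr1. Qed.

Lemma Zloc_invn p n : coprime p n -> n%:R^-1 \in Zloc p.
Proof.
case: n => [|n] cpn; first by rewrite invr0 rpred0.
by apply/ZlocP; exists n.+1; rewrite // mulVf ?rpred1 ?pnatr_eq0.
Qed.

(** A denominator greater than 1 would have a prime divisor. *)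
Lemma int_Zloc x : (forall p, prime p -> x \in Zloc p) -> x \is a Num.int.
Proof.
move=> xZ; suff d1 : denq x = 1 by rewrite -[x]divq_num_den d1 divr1 intr_int.
have: (`|denq x| == 1)%N.
  apply: contraT => d1; have := pdiv_prime (n := `|denq x|).
  have d0 : (0 < `|denq x|)%N by rewrite absz_gt0 denq_eq0.
  move/(_ ltac:(lia)) => pr; have := xZ _ pr.
  rewrite unfold_in prime_coprime // pdiv_dvd //.
by have := denq_gt0 x; lia.
Qed.

Section Prime.
Variable p : nat.
Hypothesis pr_p : prime p.

Lemma Zloc_invu x : x \in Zloc p -> x / p%:R \notin Zloc p -> x^-1 \in Zloc p.
Proof.
move=> /ZlocP[n cn /intrP[z xn]] xp.
have n0 : n%:R != 0 :> rat.
  by rewrite pnatr_eq0; apply: contraL cn => /eqP->; rewrite /coprime gcdn0; case: p pr_p => [|[]].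
have az : `|z|%N%:R = (if 0 <= z then z else - z : int)%:~R :> rat.
  by case: z {xn} => k //=; rewrite NegzE opprK.
have p0 : p%:R != 0 :> rat by rewrite pnatr_eq0 -lt0n prime_gt0.
have cz : coprime p `|z|.
  rewrite prime_coprime //; apply: contra xp => /dvdnP[k kp].
  apply/ZlocP; exists n => //; rewrite mulrAC xn.
  have -> : z = (if 0 <= z then k%:Z else - k%:Z) * p%:Z by case: ifP; lia.
  by rewrite rmorphM /= mulfK // intr_int.
have -> : x = z%:~R / n%:R by rewrite -xn mulfK.
apply/ZlocP; exists `|z|%N => //.
rewrite invf_div az; have [->|z0] := eqVneq z 0; first by rewrite mulr0 rpred0.
case: ifP => _; rewrite ?rmorphN ?mulrN ?rpredN divfK ?intr_eq0 //; exact: natr_int.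
Qed.
End Prime.

(** * Congruences between p-integral rationals *)

(** Congruence of rationals modulo [m] times the p-integral rationals.  For
    [m = 0] it is always true, since division by zero gives zero. *)
Definition cong (p : nat) (m x y : rat) := (x - y) / m \in Zloc p.

Section Cong.
Variable p : nat.
Implicit Types m x y : rat.

Lemma cong_refl m x : cong p m x x.
Proof. by rewrite /cong subrr mul0r rpred0. Qed.

Lemma cong_sym m x y : cong p m x y -> cong p m y x.
Proof. by rewrite /cong -rpredN -mulNr opprB. Qed.

Lemma cong_trans m y x z : cong p m x y -> cong p m y z -> cong p m x z.
Proof. by move=> xy yz; rewrite /cong -[x](subrK y) -addrA mulrDl rpredD. Qed.

Lemma congD m x x' y y' : cong p m x x' -> cong p m y y' -> cong p m (x + y) (x' + y').
Proof. by move=> cx cy; rewrite /cong opprD addrACA mulrDl rpredD. Qed.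

Lemma congN m x x' : cong p m x x' -> cong p m (- x) (- x').
Proof. by move=> cx; rewrite /cong -opprD mulNr rpredN. Qed.

Lemma cong_sum m (I : Type) (r : seq I) (P : pred I) (F G : I -> rat) :
  (forall i, P i -> cong p m (F i) (G i)) ->
  cong p m (\sum_(i <- r | P i) F i) (\sum_(i <- r | P i) G i).
Proof. by move=> FG; elim/big_ind2: _ => //; [exact: cong_refl | move=> *; apply: congD]. Qed.

Lemma congM m x x' y y' : x' \in Zloc p -> y \in Zloc p ->
  cong p m x x' -> cong p m y y' -> cong p m (x * y) (x' * y').
Proof.
move=> x'Z yZ cx cy; rewrite /cong.
have -> : (x * y - x' * y') / m = (x - x') / m * y + x' * ((y - y') / m) by ring.
by apply: rpredD; apply: rpredM.
Qed.

Lemma cong_prod m (I : Type) (r : seq I) (P : pred I) (F G : I -> rat) :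
  (forall i, P i -> F i \in Zloc p) -> (forall i, P i -> G i \in Zloc p) ->
  (forall i, P i -> cong p m (F i) (G i)) ->
  cong p m (\prod_(i <- r | P i) F i) (\prod_(i <- r | P i) G i).
Proof.
move=> FZ GZ FG; elim: r => [|i r IH]; first by rewrite !big_nil; exact: cong_refl.
rewrite !big_cons; case: ifP => // Pi.
by apply: congM; [exact: GZ | exact: rpred_prod | exact: FG |].
Qed.

Lemma congV m x y : x^-1 \in Zloc p -> y^-1 \in Zloc p ->
  x != 0 -> y != 0 -> cong p m x y -> cong p m x^-1 y^-1.
Proof.
move=> xZ yZ x0 y0 xy; rewrite /cong.
have -> : x^-1 - y^-1 = (y - x) * (x^-1 * y^-1) by field; rewrite y0 x0.
by rewrite mulrAC; apply: rpredM; [exact: cong_sym | exact: rpredM].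
Qed.

Lemma cong_nat (m j k : nat) : (0 < m)%N -> j = k %[mod m] -> cong p m%:R j%:R k%:R.
Proof.
move=> m0 e; rewrite /cong (divn_eq j m) (divn_eq k m) e !natrD !natrM.
have -> : (j %/ m)%:R * m%:R + (k %% m)%:R - ((k %/ m)%:R * m%:R + (k %% m)%:R) =
  ((j %/ m)%:R - (k %/ m)%:R) * m%:R :> rat by ring.
by rewrite mulfK ?pnatr_eq0 -?lt0n // rpredB ?rpred_nat.
Qed.

End Cong.

(** Grouping the indices below v + p n by their quotient by [p]. *)
Lemma big_digits (R : Type) (idx : R) (op : Monoid.com_law idx) (p v n : nat)
    (F : nat -> R) :
  \big[op/idx]_(0 <= i < v + p * n) F i =
  op (\big[op/idx]_(0 <= l < n) \big[op/idx]_(0 <= r < p) F (r + p * l)%N)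
     (\big[op/idx]_(0 <= r < v) F (r + p * n)%N).
Proof.
have tail m k : \big[op/idx]_(m <= i < k + m) F i =
    \big[op/idx]_(0 <= r < k) F (r + m)%N.
  by rewrite -{1}[m]add0n big_addn addnK.
rewrite (@big_cat_nat _ _ _ (p * n)) ?leq_addl //= tail; congr (op _ _).
elim: n => [|n IH]; first by rewrite muln0 !big_geq.
rewrite big_nat_recr //= -IH mulnS.
by rewrite (@big_cat_nat _ _ _ (p * n)) ?leq_addl //= tail.
Qed.

Lemma eq_mem_Zloc p x y : x \in Zloc p -> y = x -> y \in Zloc p.
Proof. by move=> xZ ->. Qed.

Section Prime.
Variable p : nat.
Hypothesis pr_p : prime p.

Let p_gt0 : (0 < p)%N := prime_gt0 pr_p.
Let p0 : p%:R != 0 :> rat.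
Proof. by rewrite pnatr_eq0 -lt0n. Qed.

Lemma Zloc_natV n : (n%:R / p%:R \in Zloc p) = (p %| n)%N.
Proof.
apply/idP/idP => [/ZlocP[k ck /intrP[z e]] | /dvdnP[k ->]]; last first.
  by rewrite natrM mulfK // rpred_nat.
have /eqP : (n * k)%N%:Z%:~R = (z * p%:Z)%:~R :> rat.
  by rewrite [in RHS]intrM -e -!pmulrn natrM mulrAC divfK.
rewrite eqr_int => /eqP /(congr1 absz); rewrite abszM /= => {}e.
by rewrite -(@Gauss_dvdl _ _ k) // e dvdn_mull.
Qed.

Lemma p_part n : (0 < n)%N -> exists2 m, coprime p m & n = (m * p ^ logn p n)%N.
Proof. by move=> n0; have [m cm e] := pfactor_coprime pr_p n0; exists m. Qed.

(** The p-part of [n] is what matters modulo [n], and modulo a power of [p] the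
    denominator of [a] is invertible. *)
Lemma Zloc_approx a n : (0 < n)%N -> a \in Zloc p ->
  exists k : nat, cong p n%:R a k%:R.
Proof.
move=> n0 /ZlocP[d cd /intrP[z ad]].
have [m cm ->] := p_part n0; set s := logn p n.
have d0 : d%:R != 0 :> rat.
  rewrite pnatr_eq0; apply: contraL cd => /eqP->.
  by rewrite /coprime gcdn0; case: p pr_p => [|[]].
have q0 : (p ^ s > 0)%N by rewrite expn_gt0 p_gt0.
have m0 : m%:R != 0 :> rat.
  rewrite pnatr_eq0; apply: contraL cm => /eqP->.
  by rewrite /coprime gcdn0; case: p pr_p => [|[]].
have q0' : (p ^ s)%:R != 0 :> rat by rewrite pnatr_eq0 -lt0n.
have [k [w zkw]] : exists k : nat, exists w : int, z = k%:Z * d + (p ^ s)%:Z * w.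
  have /coprimezP[[u v] /= uv] : coprimez d%:Z (p ^ s)%:Z.
    by rewrite /coprimez /gcdz /= -[_ == 1]/(coprime d (p ^ s)) coprime_sym coprimeXl.
  have M0 : (p ^ s)%:Z != 0 by lia.
  have hk := modz_ge0 (u * z) M0; have e1 := divz_eq (u * z) (p ^ s)%:Z.
  exists `|((u * z) %% (p ^ s)%:Z)%Z|%N, (z * v + (u * z %/ (p ^ s)%:Z)%Z * d).
  rewrite (gez0_abs hk); rewrite -[LHS]mulr1 -{1}uv; move: e1.
  by set q := (_ %/ _)%Z; set r := (_ %% _)%Z => e1; rewrite mulrDr mulrA [z * u]mulrC e1; ring.
exists k; rewrite /cong; apply: (@eq_mem_Zloc _ (w%:~R * d%:R^-1 * m%:R^-1)).
  by do 2?apply: rpredM; rewrite ?rpred_int ?Zloc_invn.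
have -> : a = z%:~R / d%:R by rewrite -ad mulfK.
rewrite zkw intrD !intrM -!pmulrn natrM; field.
by rewrite q0' m0 d0.
Qed.
End Prime.

(** * Base p digits of rising factorials *)

(** [a'] is the Dwork prime of [a]: the unique translate of [a] by a digit [t] that
    is divisible by [p], divided by [p]. *)
Definition dwork_prime (p : nat) (a a' : rat) (t : nat) :=
  [/\ (t < p)%N, a \in Zloc p, a' \in Zloc p, 0 < a & a' * p%:R = a + t%:R].

(** The factors a + i that are p-adic units, for i in the block [p * l], ...,
    [p * l + p - 1]. *)
Definition unit_block p (a : rat) t l : rat :=
  \prod_(0 <= r < p | r != t) (a + (r + p * l)%:R).

(** What remains of the rising factorial of length v + p n when the factors
    divisible by [p] in the [n] complete blocks are removed. *)
Definition unit_rising p a t v n : rat :=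
  (\prod_(0 <= l < n) unit_block p a t l) * \prod_(0 <= r < v) (a + (r + p * n)%:R).

Lemma risingE a k : rising a k = \prod_(0 <= i < k) (a + i%:R).
Proof. by rewrite big_mkord. Qed.

Lemma rising1 k : rising 1 k = k`!%:R.
Proof.
rewrite risingE; elim: k => [|k IH]; first by rewrite big_geq.
by rewrite big_nat_recr //= IH factS natrM mulrC nat1r.
Qed.

Section Prime.
Variable p : nat.
Hypothesis pr_p : prime p.

Let p_gt0 : (0 < p)%N := prime_gt0 pr_p.
Let p0 : p%:R != 0 :> rat.
Proof. by rewrite pnatr_eq0 -lt0n. Qed.

(** Factorials are rising factorials of 1, which is its own Dwork prime. *)
Lemma dwork_prime1 : dwork_prime p 1 1 p.-1.
Proof. by split; rewrite ?rpred1 ?ltr01 ?prednK // mul1r nat1r prednK. Qed.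

Lemma dwork_prime_gt0 a a' t : dwork_prime p a a' t -> 0 < a'.
Proof.
case=> _ _ _ a0 e; rewrite -(pmulr_lgt0 (x := p%:R)) ?ltr0n // e.
by rewrite ltr_wpDr ?ler0n.
Qed.

Lemma dwork_prime_exists a : a \in Zloc p -> 0 < a -> exists a' t, dwork_prime p a a' t.
Proof.
move=> aZ a0; have [k ak] := Zloc_approx pr_p p_gt0 (rpredNr aZ).
exists ((a + (k %% p)%:R) / p%:R), (k %% p)%N; split=> //; rewrite ?divfK ?ltn_mod //.
have : cong p p%:R (- a) (k %% p)%:R.
  by apply: cong_trans ak (cong_nat _ _ _); rewrite ?modn_mod.
by rewrite /cong -opprD mulNr rpredN.
Qed.

Section Factor.
Variables (a a' : rat) (t : nat).
Hypothesis aa' : dwork_prime p a a' t.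

(** The multiples of [p] among the a + i are p times the a' + l. *)
Lemma pred_digit l : a + (t + p * l)%:R = p%:R * (a' + l%:R).
Proof. by have [_ _ _ _ e] := aa'; rewrite natrD natrM addrA -e; ring. Qed.

Lemma rising_digits v n :
  rising a (v + p * n) = p%:R ^+ n * rising a' n * unit_rising p a t v n.
Proof.
rewrite !risingE big_digits /unit_rising mulrA; congr (_ * _).
elim: n => [|n IH]; first by rewrite !big_geq // !mulr1.
rewrite !big_nat_recr //= IH exprS.
have -> : \prod_(0 <= r < p) (a + (r + p * n)%:R) =
    p%:R * (a' + n%:R) * unit_block p a t n.
  rewrite -pred_digit (bigD1_seq t) //= ?iota_uniq // mem_index_iota.
  by case: aa'.
ring.
Qed.

Lemma unit_digit r l : (r < p)%N -> r != t -> (a + (r + p * l)%:R)^-1 \in Zloc p.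
Proof.
have [tp aZ a'Z a0 e] := aa'; move=> rp rt.
apply: Zloc_invu => //; first by rewrite rpredD ?rpred_nat.
apply: contra rt => h.
have : (r%:R - t%:R) / p%:R \in Zloc p.
  have -> : (r%:R - t%:R) / p%:R =
     (a + (r + p * l)%:R) / p%:R - a' - l%:R :> rat.
    by rewrite natrD natrM -[a'](mulfK p0) e; field.
  by rewrite rpredB ?rpred_nat // rpredB.
have [rt|tr] := leqP t r.
  by rewrite -natrB // Zloc_natV // => /dvdnP[[|k]]; nia.
rewrite -rpredN -mulNr opprB -natrB 1?ltnW // Zloc_natV // => /dvdnP[[|k]]; nia.
Qed.

Lemma unit_block_Zloc l : unit_block p a t l \in Zloc p.
Proof. by have [_ aZ _ _ _] := aa'; rewrite rpred_prod // => r _; rewrite rpredD ?rpred_nat. Qed.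

Lemma unit_blockV l : (unit_block p a t l)^-1 \in Zloc p.
Proof.
rewrite /unit_block -prodfV big_nat_cond rpred_prod // => r /andP[/andP[_ rp] rt].
exact: unit_digit.
Qed.

Lemma unit_rising_Zloc v n : unit_rising p a t v n \in Zloc p.
Proof.
have [_ aZ _ _ _] := aa'.
apply: rpredM; apply: rpred_prod => r _; first exact: unit_block_Zloc.
by rewrite rpredD ?rpred_nat.
Qed.

(** The incomplete last block contains its multiple of [p] as soon as it goes
    beyond the digit [t]. *)
Lemma unit_rising_dvd v n : (t < v)%N ->
  unit_rising p a t v n / (p%:R * (a' + n%:R)) \in Zloc p.
Proof.
have [_ aZ _ _ _] := aa'; move=> tv.
rewrite -pred_digit /unit_rising.
have -> : \prod_(0 <= r < v) (a + (r + p * n)%:R) =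
    (\prod_(0 <= r < v | r != t) (a + (r + p * n)%:R)) * (a + (t + p * n)%:R).
  by rewrite (bigD1_seq t) ?iota_uniq ?mem_index_iota //= mulrC.
rewrite mulrA mulfK; last first.
  by rewrite pred_digit mulf_neq0 // gt_eqF // ltr_wpDr ?ler0n // (dwork_prime_gt0 aa').
apply: rpredM; apply: rpred_prod => r _; first exact: unit_block_Zloc.
by rewrite rpredD ?rpred_nat.
Qed.

End Factor.

(** The product of the units in a window of length M does not depend on the
    window modulo M: moving it to the right by one replaces c by c + M. *)
Lemma window_prod M c : (p %| M)%N ->
  \prod_(c <= i < M + c | coprime p i) i = \prod_(0 <= i < M | coprime p i) i %[mod M].
Proof.
move=> pM; elim: c => [|c IH]; first by rewrite addn0.
have [->|M0] := posnP M; first by rewrite !big_geq.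
have cM : (c < M + c)%N by rewrite -[X in (X < _)%N]add0n ltn_add2r.
have copM : coprime p (M + c) = coprime p c.
  by case/dvdnP: pM => k ->; rewrite -(coprime_modr _ (_ + _)) modnMDl coprime_modr.
rewrite -IH addnS big_mkcond [in RHS]big_mkcond.
rewrite (big_nat_recr (M + c)) // (big_ltn cM) copM /= mulnC.
by case: ifP => // _; rewrite -modnMml modnDl modnMml.
Qed.

(** Modulo p N the number [a] may be replaced by a natural number, and the product
    becomes one over a window of length p N.  The right-hand side does not depend
    on [a], so that it cancels in the ratio of (a)_k by k!. *)
Lemma unit_block_window a a' t : dwork_prime p a a' t -> forall n N,
  cong p (p * N)%:R (\prod_(n <= l < N + n) unit_block p a t l)
     (\prod_(0 <= i < p * N | coprime p i) i)%:R.
Proof.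
move=> aa' n N; have [tp aZ a'Z a0 e] := aa'.
have [->|N0] := posnP N; first by rewrite muln0 !big_geq //; exact: cong_refl.
have M0 : (0 < p * N)%N by rewrite muln_gt0 p_gt0.
have [k ak] := Zloc_approx pr_p M0 aZ.
have kt : (p %| k + t)%N.
  rewrite -Zloc_natV // natrD.
  have -> : (k%:R + t%:R) / p%:R = a' - ((a - k%:R) / (p * N)%:R) * N%:R :> rat.
    rewrite natrM -[a'](mulfK p0) e; field.
    by rewrite p0 pnatr_eq0 -lt0n N0.
  by rewrite rpredB // rpredM ?rpred_nat.
have copE r l : (r < p)%N -> coprime p (r + p * (l + n) + k) = (r != t).
  move=> rp; rewrite -(coprime_modr _ (_ + k)) addnAC addnC mulnC modnMDl coprime_modr.
  rewrite prime_coprime //; apply/idP/idP; apply: contra; last first.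
    move=> rk; have [|] := leqP r t => rt.
      have : (p %| t - r)%N by have := dvdn_sub kt rk; rewrite (_ : _ - _ = t - r)%N //; lia.
      by move/dvdnP=> [[|j]]; nia.
    have : (p %| r - t)%N by have := dvdn_sub rk kt; rewrite (_ : _ - _ = r - t)%N //; lia.
    by move/dvdnP=> [[|j]]; nia.
  by move/eqP->; rewrite addnC.
apply: cong_trans (cong_nat _ M0 (window_prod (k + p * n) (dvdn_mulr N (dvdnn p)))).
rewrite -{1}[n]add0n big_addn addnK.
have -> c : (\prod_(c <= i < p * N + c | coprime p i) i =
    \prod_(0 <= i < p * N) (if coprime p (i + c) then (i + c)%N else 1))%N.
  by rewrite -{1}[c]add0n big_addn addnK big_mkcond.
have -> : \prod_(0 <= i < p * N)
     (if coprime p (i + (k + p * n)) then (i + (k + p * n))%N else 1%N) =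
   \prod_(0 <= l < N) \prod_(0 <= r < p | r != t) (r + p * (l + n) + k)%N.
  have := big_digits muln p 0 N (fun i => if coprime p (i + (k + p * n)) then (i + (k + p * n))%N else 1%N).
  rewrite add0n => ->; rewrite [\big[_/_]_(0 <= r < 0) _]big_geq //= muln1.
  apply: eq_bigr => l _; rewrite [RHS]big_mkcond; apply: eq_big_nat => r /andP[_ rp].
  by rewrite -(copE r l) //; have -> : (r + p * l + (k + p * n) = r + p * (l + n) + k)%N by ring.
rewrite natr_prod.
apply: cong_prod => l _; first exact: unit_block_Zloc aa' _; first exact: rpred_nat.
rewrite natr_prod.
apply: cong_prod => r _; first by rewrite rpredD ?rpred_nat.
  exact: rpred_nat.
rewrite [in X in cong _ _ _ X]natrD [X in cong _ _ _ X]addrC.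
by apply: congD => //; exact: cong_refl.
Qed.

(** Lipschitz condition on the integers below [K]: f x - f y is divisible by
    c * (x - y). *)
Definition lip (c : rat) (K : nat) (f : nat -> rat) :=
  forall x y, (x < K)%N -> (y < K)%N -> cong p (c * (x%:R - y%:R)) (f x) (f y).

(** The ratio of (a)_k / k! for k = v + p n by (a')_n / n!, see [rising_frob]. *)
Definition frob_ratio (a : rat) t v n := unit_rising p a t v n / unit_rising p 1 p.-1 v n.

Section Ratio.
Variables (a a' : rat) (t v : nat).
Hypotheses (aa' : dwork_prime p a a' t) (vp : (v < p)%N).

Lemma unit_risingV n : (unit_rising p 1 p.-1 v n)^-1 \in Zloc p.
Proof.
rewrite /unit_rising invfM -!prodfV; apply: rpredM.
  by apply: rpred_prod => l _; exact: unit_blockV dwork_prime1 _.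
rewrite big_nat_cond; apply: rpred_prod => r /andP[/andP[_ rv] _].
by apply: unit_digit dwork_prime1 _ _ _ _; lia.
Qed.

Lemma frob_ratio_Zloc n : frob_ratio a t v n \in Zloc p.
Proof. by apply: rpredM; [exact: unit_rising_Zloc aa' _ _ | exact: unit_risingV]. Qed.

Lemma unit_rising1_neq0 n : unit_rising p 1 p.-1 v n != 0.
Proof.
have h i : 1 + i%:R != 0 :> rat by rewrite nat1r pnatr_eq0.
by apply: mulf_neq0; rewrite prodf_seq_neq0; apply/allP => l _ //=; rewrite prodf_seq_neq0;
  apply/allP => r _; rewrite h implybT.
Qed.

Lemma rising_frob n : rising a (v + p * n) / (v + p * n)`!%:R =
  rising a' n / n`!%:R * frob_ratio a t v n.
Proof.
rewrite -!rising1 (rising_digits aa') (rising_digits dwork_prime1) /frob_ratio.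
have := unit_rising1_neq0 n; have : rising 1 n != 0 by rewrite rising1 pnatr_eq0 -lt0n fact_gt0.
by move=> h1 h2; field; rewrite h1 h2 expf_neq0.
Qed.

Lemma frob_ratio_dvd n : (t < v)%N ->
  frob_ratio a t v n / (p%:R * (a' + n%:R)) \in Zloc p.
Proof.
move=> tv; rewrite /frob_ratio mulrAC.
by apply: rpredM; [exact: unit_rising_dvd | exact: unit_risingV].
Qed.

(** The numerator and the denominator are multiplied by the same unit window
    product modulo p N when [n] increases by [N]. *)
Lemma frob_ratio_step n N : cong p (p * N)%:R (frob_ratio a t v (N + n)) (frob_ratio a t v n).
Proof.
have [tp aZ a'Z a0 e] := aa'.
have sh b r : cong p (p * N)%:R (b + (r + p * (N + n))%:R) (b + (r + p * n)%:R).
  rewrite /cong mulnDr addnCA natrD addrCA addrK.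
  have [->|/negPf N0] := eqVneq (p * N)%N 0%N; first by rewrite mul0r rpred0.
  by rewrite divff ?rpred1 // pnatr_eq0 N0.
have split b s : unit_rising p b s v (N + n) =
   (\prod_(0 <= l < n) unit_block p b s l) *
   ((\prod_(n <= l < N + n) unit_block p b s l) * \prod_(0 <= r < v) (b + (r + p * (N + n))%:R)).
  by rewrite mulrA /unit_rising (@big_cat_nat _ _ _ n) ?leq_addl.
have unitr b b' s : dwork_prime p b b' s -> cong p (p * N)%:R
   (unit_rising p b s v (N + n)) (unit_rising p b s v n *
     (\prod_(0 <= i < p * N | coprime p i) i)%:R).
  move=> bb'; have [_ bZ _ _ _] := bb'.
  rewrite split {1}/unit_rising -mulrA.
  apply: congM; last 2 first.
  - exact: cong_refl.
  - rewrite [X in cong _ _ _ X]mulrC; apply: congM; first exact: rpred_nat.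
    + by apply: rpred_prod => r _; rewrite rpredD ?rpred_nat.
    + exact: unit_block_window bb' _ _.
    apply: cong_prod => r _; rewrite ?rpredD ?rpred_nat //; exact: sh.
  - by apply: rpred_prod => r _; exact: unit_block_Zloc bb' _.
  apply: rpredM; apply: rpred_prod => r _; first exact: unit_block_Zloc bb' _.
  by rewrite rpredD ?rpred_nat.
set W := (\prod_(0 <= i < _ | _) _)%:R in unitr.
have W0 : W != 0.
  rewrite /W pnatr_eq0 -lt0n; apply/prodn_cond_gt0 => -[|i] //.
  by rewrite /coprime gcdn0; case: p pr_p => [|[]].
have WV : W^-1 \in Zloc p.
  apply: Zloc_invn; rewrite /W; elim/big_ind: _ => //; first exact: coprimen1.
  by move=> x y cx cy; rewrite coprimeMr cx.
have -> : frob_ratio a t v n = (unit_rising p a t v n * W) / (unit_rising p 1 p.-1 v n * W).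
  by rewrite /frob_ratio; field; rewrite W0 unit_rising1_neq0.
apply: congM; last 2 first.
- exact: unitr aa'.
- apply: congV; first exact: unit_risingV.
  + by rewrite invfM; apply: rpredM; first exact: unit_risingV.
  + exact: unit_rising1_neq0.
  + by rewrite mulf_neq0 ?unit_rising1_neq0.
  exact: unitr dwork_prime1.
- by apply: rpredM; [exact: unit_rising_Zloc aa' _ _ | exact: rpred_nat].
exact: unit_risingV.
Qed.

Lemma frob_ratio_lip K : lip p%:R K (frob_ratio a t v).
Proof.
have lt_case x y : (x <= y)%N -> cong p (p%:R * (y%:R - x%:R)) (frob_ratio a t v y) (frob_ratio a t v x).
  by move=> xy; have := frob_ratio_step x (y - x); rewrite subnK // natrM natrB.
move=> x y _ _; case/orP: (leq_total x y) => /lt_case //.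
move=> h; rewrite -[_ * _]opprK -mulrN opprB; apply: cong_sym.
by move: h; rewrite /cong invrN mulrN rpredN.
Qed.

End Ratio.
End Prime.

(** * Lipschitz ratios and the coefficients of F and G *)

Section Lip.
Variable p : nat.

Lemma lip_mul c K f g : (forall x, (x < K)%N -> f x \in Zloc p) ->
  (forall x, (x < K)%N -> g x \in Zloc p) ->
  lip p c K f -> lip p c K g -> lip p c K (fun x => f x * g x).
Proof. by move=> fZ gZ lf lg x y xK yK; apply: congM; rewrite ?fZ ?gZ //; [exact: lf | exact: lg]. Qed.

Lemma lip_rev c K f : lip p c K f -> lip p c K (fun x => f (K - x.+1)%N).
Proof.
move=> lf x y xK yK.
have := lf _ _ (_ : K - y.+1 < K)%N (_ : K - x.+1 < K)%N.
rewrite !natrB //; move/(_ ltac:(lia) ltac:(lia))/cong_sym.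
by rewrite (_ : K%:R - y.+1%:R - (K%:R - x.+1%:R) = x%:R - y%:R) // -!natr1; ring.
Qed.

Lemma lip_div c K f : lip p c K f -> lip p 1 K (fun x => f x / c).
Proof.
move=> lf x y xK yK; have := lf x y xK yK; rewrite /cong invfM mul1r.
by rewrite (_ : (f x - f y) * (c^-1 * _) = (f x / c - f y / c) / (x%:R - y%:R)) //; ring.
Qed.

Lemma lip_digits K N v f : (forall i, (i < N)%N -> (v + p * i < K)%N) ->
  lip p 1 K f -> lip p p%:R N (fun i => f (v + p * i)%N).
Proof.
move=> NK lf x y xN yN; have := lf _ _ (NK x xN) (NK y yN).
by rewrite !natrD !natrM (_ : 1 * _ = p%:R * (x%:R - y%:R)) //; ring.
Qed.

End Lip.

Definition harm (a : rat) k : rat := \sum_(0 <= i < k) (a + i%:R)^-1.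

(** The factor by which the coefficients of G differ from those of F. *)
Definition log_coef (a1 a2 : rat) k : rat :=
  (harm a1 k - harm 1 k) + (harm a2 k - harm 1 k).

Lemma GseriesE a1 a2 k : Gseries a1 a2 k = Fseries a1 a2 k * log_coef a1 a2 k.
Proof.
rewrite /Gseries /log_coef /harm -!sumrB !big_mkord.
by congr (_ * (_ + _)); apply: eq_bigr => i _; rewrite !mul1r.
Qed.

Lemma FseriesE a1 a2 k :
  Fseries a1 a2 k = (rising a1 k / k`!%:R) * (rising a2 k / k`!%:R).
Proof. by rewrite /Fseries; field; rewrite pnatr_eq0 -lt0n fact_gt0. Qed.

Section Prime.
Variable p : nat.
Hypothesis pr_p : prime p.

Let p_gt0 : (0 < p)%N := prime_gt0 pr_p.
Let p_gt1 : (1 < p)%N := prime_gt1 pr_p.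
Let p0 : p%:R != 0 :> rat.
Proof. by rewrite pnatr_eq0 -lt0n. Qed.

(** Removing the last base p digit of [k] replaces [a] by [a'] up to a p-integral
    factor. *)
Lemma rising_Zloc a k : a \in Zloc p -> 0 < a -> rising a k / k`!%:R \in Zloc p.
Proof.
elim/ltn_ind: k a => k IH a aZ a0.
have [k0|k_gt0] := posnP k.
  by rewrite k0 risingE big_geq // divr1 rpred1.
have [a' [t aa']] := dwork_prime_exists pr_p aZ a0.
have [_ _ a'Z _ _] := aa'.
rewrite (divn_eq k p) mulnC addnC (rising_frob pr_p _ aa').
apply: rpredM; last by apply: (frob_ratio_Zloc pr_p aa'); rewrite ltn_mod.
by apply: IH a'Z (dwork_prime_gt0 pr_p aa'); rewrite ltn_Pdiv.
Qed.

Lemma Fseries_Zloc a1 a2 k : a1 \in Zloc p -> 0 < a1 -> a2 \in Zloc p -> 0 < a2 ->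
  Fseries a1 a2 k \in Zloc p.
Proof. by move=> *; rewrite FseriesE; apply: rpredM; apply: rising_Zloc. Qed.

(** The terms whose denominator is a unit are p-integral; the others are those of
    the sum for [a'], plus one more when the last block contains it. *)
Lemma harm_digits a a' t v n : dwork_prime p a a' t -> (v <= p)%N ->
  harm a (v + p * n) - harm a' n / p%:R - (t < v)%:R / (p%:R * (a' + n%:R)) \in Zloc p.
Proof.
move=> aa' vp.
have [tp _ _ _ _] := aa'.
have block N l : (N <= p)%N -> \sum_(0 <= r < N) (a + (r + p * l)%:R)^-1 -
    (t < N)%:R / (p%:R * (a' + l%:R)) \in Zloc p.
  move=> Np; have [tN|Nt] := ltnP t N.
    rewrite (bigD1_seq t) ?mem_index_iota ?iota_uniq //= (pred_digit aa') mul1r addrAC subrr add0r.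
    rewrite big_nat_cond rpred_sum // => r /andP[/andP[_ rN] rt].
    by apply: (unit_digit pr_p aa') => //; lia.
  rewrite mul0r subr0 big_nat_cond rpred_sum // => r /andP[/andP[_ rN] _].
  by apply: (unit_digit pr_p aa'); lia.
rewrite /harm big_digits mulr_suml /=.
rewrite (_ : forall x y z u : rat, x + y - z - u = (x - z) + (y - u)); last by move=> *; ring.
apply: rpredD; last exact: block.
rewrite -sumrB rpred_sum // => l _.
by have := block p l (leqnn p); rewrite tp mul1r invfM mulrC.
Qed.

Section Pair.
Variables (a1 a1' a2 a2' : rat) (t1 t2 : nat).
Hypotheses (d1 : dwork_prime p a1 a1' t1) (d2 : dwork_prime p a2 a2' t2).

Definition frob_ratio2 v n := frob_ratio p a1 t1 v n * frob_ratio p a2 t2 v n.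

Lemma Fseries_frob v n : (v < p)%N ->
  Fseries a1 a2 (v + p * n) = Fseries a1' a2' n * frob_ratio2 v n.
Proof.
move=> vp; rewrite !FseriesE (rising_frob pr_p _ d1) (rising_frob pr_p _ d2).
by rewrite /frob_ratio2; ring.
Qed.

Lemma frob_ratio2_Zloc v n : (v < p)%N -> frob_ratio2 v n \in Zloc p.
Proof.
by move=> vp; apply: rpredM;
  [exact: (frob_ratio_Zloc pr_p d1) | exact: (frob_ratio_Zloc pr_p d2)].
Qed.

Lemma frob_ratio2_lip v K : (v < p)%N -> lip p p%:R K (frob_ratio2 v).
Proof.
move=> vp; apply: lip_mul => [x _|x _||].
- exact: (frob_ratio_Zloc pr_p d1).
- exact: (frob_ratio_Zloc pr_p d2).
- exact: (frob_ratio_lip pr_p d1).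
- exact: (frob_ratio_lip pr_p d2).
Qed.

(** The extra terms 1 / (p (a' + n)) of [harm_digits] are absorbed by the
    coefficient of F, which is divisible by p (a' + n) in that case. *)
Lemma Gseries_frob v n : (v < p)%N ->
  Gseries a1 a2 (v + p * n) - Fseries a1 a2 (v + p * n) * log_coef a1' a2' n / p%:R
    \in Zloc p.
Proof.
move=> vp; rewrite GseriesE -mulrA -mulrBr.
have [_ a1Z a1'Z a1_gt0 _] := d1; have [_ a2Z a2'Z a2_gt0 _] := d2.
have h1 := harm_digits n d1 (ltnW vp); have h2 := harm_digits n d2 (ltnW vp).
have h3 := harm_digits n (dwork_prime1 pr_p) (ltnW vp).
have t1v : (p.-1 < v)%N = false by lia.
rewrite t1v mul0r subr0 in h3.
pose A := Fseries a1 a2 (v + p * n).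
have AZ : A \in Zloc p by exact: Fseries_Zloc.
have A'Z : Fseries a1' a2' n \in Zloc p.
  by apply: Fseries_Zloc => //; [exact: dwork_prime_gt0 d1 | exact: dwork_prime_gt0 d2].
have D1 : A * ((t1 < v)%:R / (p%:R * (a1' + n%:R))) \in Zloc p.
  case: ltnP => tv; last by rewrite mul0r mulr0 rpred0.
  rewrite mul1r /A Fseries_frob // /frob_ratio2.
  have r4 (x y z u : rat) : x * (y * z) * u = (x * z) * (y * u) by ring.
  rewrite r4; apply: rpredM; last exact: (frob_ratio_dvd pr_p d1).
  by apply: rpredM => //; exact: (frob_ratio_Zloc pr_p d2).
have D2 : A * ((t2 < v)%:R / (p%:R * (a2' + n%:R))) \in Zloc p.
  case: ltnP => tv; last by rewrite mul0r mulr0 rpred0.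
  rewrite mul1r /A Fseries_frob // /frob_ratio2.
  have r4 (x y z u : rat) : x * (y * z) * u = (x * y) * (z * u) by ring.
  rewrite r4; apply: rpredM; last exact: (frob_ratio_dvd pr_p d2).
  by apply: rpredM => //; exact: (frob_ratio_Zloc pr_p d1).
rewrite -/A /log_coef.
move: h1 h2 h3 D1 D2; set x1 := _ / (p%:R * (a1' + _)); set x2 := _ / (p%:R * (a2' + _)).
move=> h1 h2 h3 D1 D2.
apply: eq_mem_Zloc (rpredD (rpredD D1 D2) (rpredM AZ (rpredB (rpredD h1 h2) (rpredD h3 h3)))) _.
by ring.
Qed.

End Pair.
End Prime.

(** * The antisymmetric convolution sum *)

(** For j = v + p i at most m = k + p L, the last digit of m - j is [codigit p k v];
    [ndigits k L v] is the number of such i for a given v. *)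
Definition codigit p k v := (if v <= k then k - v else p + k - v)%N.
Definition ndigits k L v := (L + (v <= k))%N.

Section Digits.
Variables (p k L : nat).
Hypothesis kp : (k < p)%N.

Lemma codigit_lt v : (v < p)%N -> (codigit p k v < p)%N.
Proof. by rewrite /codigit; case: ifP; lia. Qed.

Lemma codigitK v : (v < p)%N -> codigit p k (codigit p k v) = v.
Proof. by rewrite /codigit; case: (leqP v k) => h1 h2; case: ifP; lia. Qed.

Lemma ndigits_codigit v : (v < p)%N -> ndigits k L (codigit p k v) = ndigits k L v.
Proof. by rewrite /codigit /ndigits; case: (leqP v k) => h1 h2; congr (_ + nat_of_bool _)%N; lia. Qed.

Lemma digits_le v i : (v < p)%N -> (i < ndigits k L v)%N -> (v + p * i <= k + p * L)%N.
Proof.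
rewrite /ndigits; case: (leqP v k) => vk vp /=; rewrite ?addn1 ?addn0 => iL.
  by apply: leq_add => //; rewrite leq_mul2l -ltnS iL orbT.
have : (p * i.+1 <= p * L)%N by rewrite leq_mul2l iL orbT.
by rewrite mulnS; lia.
Qed.

Lemma digits_sub v i : (v < p)%N -> (i < ndigits k L v)%N ->
  (k + p * L - (v + p * i) = codigit p k v + p * (ndigits k L v - i.+1))%N.
Proof.
rewrite /ndigits /codigit; case: (leqP v k) => vk vp /= iL.
  have -> : (L + 1 - i.+1 = L - i)%N by lia.
  have : (i <= L)%N by lia.
  move=> {}iL; rewrite mulnBr; have : (p * i <= p * L)%N by rewrite leq_mul2l iL orbT.
  by lia.
rewrite addn0 mulnBr mulnS.
have : (p * i.+1 <= p * L)%N by rewrite leq_mul2l; apply/orP; right; lia.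
by rewrite mulnS; lia.
Qed.

Lemma sum_digits (f : nat -> rat) :
  \sum_(0 <= j < (k + p * L).+1) f j =
  \sum_(0 <= v < p) \sum_(0 <= i < ndigits k L v) f (v + p * i)%N.
Proof.
rewrite -addSn big_digits /= exchange_big /=.
rewrite (_ : \sum_(0 <= r < k.+1) _ = \sum_(0 <= v < p) if (v <= k)%N then f (v + p * L)%N else 0).
  rewrite -big_split; apply: eq_big_nat => v vp.
  rewrite /ndigits; case: (leqP v k) => vk; last by rewrite addn0 /= addr0.
  by rewrite addn1 big_nat_recr /=.
by rewrite (big_nat_widen _ _ p) // big_mkcond; apply: eq_bigr => v _; rewrite ltnS.
Qed.

(** [codigit p k] is an involution of the digits. *)
Lemma sum_codigit (G : nat -> rat) :
  \sum_(0 <= v < p) G (codigit p k v) = \sum_(0 <= v < p) G v.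
Proof.
rewrite !big_mkord.
pose h (v : 'I_p) := Ordinal (codigit_lt (ltn_ord v)).
have hK : involutive h by move=> v; apply: val_inj; rewrite /= codigitK.
by rewrite [RHS](reindex_inj (inv_inj hK)).
Qed.

End Digits.

Lemma sum_rev N (f : nat -> rat) :
  \sum_(0 <= i < N) f (N - i.+1)%N = \sum_(0 <= i < N) f i.
Proof. by rewrite [RHS]big_nat_rev. Qed.

Section Prime.
Variable p : nat.
Hypothesis pr_p : prime p.

Let p_gt0 : (0 < p)%N := prime_gt0 pr_p.
Let p_gt1 : (1 < p)%N := prime_gt1 pr_p.
Let p0 : p%:R != 0 :> rat.
Proof. by rewrite pnatr_eq0 -lt0n. Qed.

(** By antisymmetry the sum vanishes if G is replaced by F, hence the Lipschitz
    condition has to compensate the denominators of the coefficients of G only.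
    Write j = v + p i.  Up to p-integral terms the coefficient of G at j is
    Phi_v(i) times that of G' at i, divided by p.  Collecting the factors
    Phi and phi into psi_v(i), the terms of opposite digits v and v* pair up to an
    antisymmetric sum for G', F' and psi_v, and psi_v, a product of functions
    that are Lipschitz with constant p, makes up for the division by p. *)
Theorem Gseries_lip_sum n : forall (a1 a2 : rat) (phi : nat -> rat),
  a1 \in Zloc p -> 0 < a1 -> a2 \in Zloc p -> 0 < a2 -> lip p 1 n phi ->
  \sum_(0 <= j < n) Gseries a1 a2 j * Fseries a1 a2 (n - j.+1)%N *
    (phi j - phi (n - j.+1)%N) \in Zloc p.
Proof.
elim/ltn_ind: n => n IH a1 a2 phi0 a1Z a1_gt0 a2Z a2_gt0 lip_phi0.
case: n => [|[|m]] in IH lip_phi0 *; first by rewrite big_geq ?rpred0.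
  by rewrite big_nat1 subrr mulr0 rpred0.
(* only differences of phi0 occur, and phi0 minus its value at 0 is p-integral *)
pose phi j := phi0 j - phi0 0%N.
rewrite (eq_bigr (fun j => Gseries a1 a2 j * Fseries a1 a2 (m.+2 - j.+1)%N *
  (phi j - phi (m.+2 - j.+1)%N))); last by move=> j _; rewrite /phi; ring.
have lip_phi : lip p 1 m.+2 phi.
  by move=> x y xn yn; apply: congD; [exact: lip_phi0 | exact: cong_refl].
have phiZ j : (j < m.+2)%N -> phi j \in Zloc p.
  move=> jn; have := lip_phi0 j 0%N jn isT; rewrite /cong mul1r subr0 => h.
  have [->|j0] := posnP j; first by rewrite /phi subrr rpred0.
  apply: eq_mem_Zloc (rpredM h (rpred_nat _ j)) _.
  by rewrite divfK // pnatr_eq0 -lt0n.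
move: phi lip_phi phiZ => {phi0 lip_phi0} phi lip_phi phiZ.
have [a1' [t1 d1]] := dwork_prime_exists pr_p a1Z a1_gt0.
have [a2' [t2 d2]] := dwork_prime_exists pr_p a2Z a2_gt0.
have [_ _ a1'Z _ _] := d1; have [_ _ a2'Z _ _] := d2.
have a1'_gt0 := dwork_prime_gt0 pr_p d1; have a2'_gt0 := dwork_prime_gt0 pr_p d2.
pose k := (m.+1 %% p)%N; pose L := (m.+1 %/ p)%N.
have kp : (k < p)%N by rewrite ltn_mod.
have mE : m.+1 = (k + p * L)%N by rewrite {1}(divn_eq m.+1 p) mulnC addnC.
pose vs := codigit p k; pose nv := ndigits k L.
have vs_lt v : (v < p)%N -> (vs v < p)%N by exact: codigit_lt.
have nv_lt v : (nv v < m.+2)%N.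
  apply: leq_ltn_trans (_ : L.+1 < m.+2)%N; last by rewrite ltnS ltn_Pdiv.
  by rewrite /nv /ndigits -addn1 leq_add2l leq_b1.
pose Phi v i := frob_ratio2 p a1 a2 t1 t2 v i.
pose A' i := Fseries a1' a2' i.
pose psi v i := Phi v i * Phi (vs v) (nv v - i.+1)%N * phi (v + p * i)%N.
pose c v i := A' i * log_coef a1' a2' i * A' (nv v - i.+1)%N.
have in_range v i : (v < p)%N -> (i < nv v)%N -> (v + p * i < m.+2)%N.
  by move=> vp ilt; rewrite ltnS mE; exact: digits_le.
rewrite mE sum_digits //.
pose main := \sum_(0 <= v < p) \sum_(0 <= i < nv v)
   c v i * (psi v i - psi (vs v) (nv v - i.+1)%N) / p%:R.
(* main is the sum up to p-integral terms *)
suff mainZ : main \in Zloc p.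
  rewrite -[X in X \in _](subrK main); apply: rpredD => //.
  rewrite /main -sumrB big_nat_cond; apply: rpred_sum => v /andP[/andP[_ vp] _].
  rewrite -sumrB big_nat_cond; apply: rpred_sum => i /andP[/andP[_ iv] _].
  rewrite subSS (digits_sub kp) // -/(vs v) -/(nv v).
  have inr1 := in_range _ _ vp iv.
  have iv' : (nv v - i.+1 < nv (vs v))%N by rewrite /nv ndigits_codigit // subnSK // leq_subr.
  have inr2 := in_range _ _ (vs_lt _ vp) iv'.
  have nvs : nv (vs v) = nv v by exact: ndigits_codigit.
  have GF := Gseries_frob pr_p d1 d2 i vp.
  have F1 : Fseries a1 a2 (v + p * i)%N = A' i * Phi v i := Fseries_frob pr_p d1 d2 i vp.
  have F2 : Fseries a1 a2 (vs v + p * (nv v - i.+1))%N =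
      A' (nv v - i.+1)%N * Phi (vs v) (nv v - i.+1)%N.
    exact: (Fseries_frob pr_p d1 d2 _ (vs_lt _ vp)).
  have F2Z : Fseries a1 a2 (vs v + p * (nv v - i.+1))%N \in Zloc p by exact: Fseries_Zloc.
  apply: eq_mem_Zloc (rpredM (rpredM GF F2Z) (rpredB (phiZ _ inr1) (phiZ _ inr2))) _.
  rewrite /c /psi nvs /vs codigitK // -/(vs v).
  rewrite (_ : nv v - (nv v - i.+1).+1 = i)%N; last by rewrite subnSK // subKn // ltnW.
  rewrite F1 F2.
  by field.
have Phi_lip v K : (v < p)%N -> lip p p%:R K (Phi v) by move=> vp; exact: (frob_ratio2_lip pr_p d1 d2).
have PhiZ v i : (v < p)%N -> Phi v i \in Zloc p by move=> vp; exact: (frob_ratio2_Zloc pr_p d1 d2).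
(* exchange v and its codigit in the subtracted terms *)
have -> : main = \sum_(0 <= v < p) \sum_(0 <= i < nv v)
    c v i * (psi v i / p%:R - psi v (nv v - i.+1)%N / p%:R).
  pose c1 v i := c v i / p%:R.
  transitivity (\sum_(0 <= v < p) \sum_(0 <= i < nv v) c1 v i * psi v i -
                \sum_(0 <= v < p) \sum_(0 <= i < nv v) c1 v i * psi (vs v) (nv v - i.+1)%N).
    rewrite /main -sumrB; apply: eq_bigr => v _; rewrite -sumrB; apply: eq_bigr => i _.
    by rewrite /c1; field.
  rewrite -[X in _ - X](sum_codigit kp) -sumrB; apply: eq_big_nat => v /andP[_ vp].
  rewrite -/(vs v) /nv ndigits_codigit // -/(nv v) -sumrB; apply: eq_bigr => i _.
  by rewrite /c1 /vs codigitK // /c /nv ndigits_codigit //; field.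
rewrite big_nat_cond; apply: rpred_sum => v /andP[/andP[_ vp] _].
have lip_psi : lip p 1 (nv v) (fun i => psi v i / p%:R).
  apply: lip_div; apply: lip_mul => [x xv|x xv||].
  - by apply: rpredM; apply: PhiZ => //; exact: vs_lt.
  - by apply: phiZ; exact: in_range.
  - apply: lip_mul => [x xv|x xv||]; [exact: PhiZ | by apply: PhiZ; exact: vs_lt | exact: Phi_lip |].
    by apply: (lip_rev (f := Phi (vs v))); apply: Phi_lip; exact: vs_lt.
  - by apply: lip_digits lip_phi => i iv; exact: in_range.
have := IH _ (nv_lt v) a1' a2' _ a1'Z a1'_gt0 a2'Z a2'_gt0 lip_psi.
by under eq_bigr => i _ do rewrite GseriesE.
Qed.

End Prime.

(** * Dwork's congruence for G / F *)

Lemma fps_coefMn (f : fps) k n : (f *+ k) n = f n *+ k.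
Proof. by elim: k => // k IH; rewrite !mulrS fps_coefD IH. Qed.

Lemma fps_coef_natM k (f : fps) n : (k%:R * f) n = k%:R * f n.
Proof. by rewrite mulr_natl fps_coefMn mulr_natl. Qed.

Lemma fps_coefM0 (f g : fps) : (f * g) 0%N = f 0%N * g 0%N.
Proof. by rewrite fps_coefM big_ord1. Qed.

Lemma fps_coefX0 (f : fps) k : (f ^+ k) 0%N = f 0%N ^+ k.
Proof. by elim: k => [|k IH]; rewrite ?expr0 // !exprS fps_coefM0 IH. Qed.

Lemma fps_coefM_recr (f g : fps) n : (f * g) n = \sum_(i < n) f i * g (n - i)%N + f n * g 0%N.
Proof. by rewrite fps_coefM big_ord_recr /= subnn. Qed.

Lemma fps_coefM_low (f g : fps) n : (forall i, (i < n)%N -> f i = 0) -> (f * g) n = f n * g 0%N.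
Proof. by move=> f0; rewrite fps_coefM_recr big1 ?add0r // => i _; rewrite f0 ?mul0r. Qed.

Lemma fps_lreg (f g h : fps) : f 0%N != 0 -> f * g = f * h -> g = h.
Proof.
move=> f0 e; rewrite -[g]mul1r -[h]mul1r.
have -> : 1 = fps_inv f * f by rewrite mulrC; apply: fpsP => n; exact/esym/(fps_mulfV f0).
by rewrite -!mulrA e.
Qed.

Lemma fps_divK (f g : fps) : f 0%N != 0 -> f * fps_div g f = g.
Proof.
move=> f0; rewrite /fps_div -[fps_mul _ _]/(g * fps_inv f) mulrCA.
have -> : f * fps_inv f = 1 by apply: fpsP => n; exact: fps_mulfV.
by rewrite mulr1.
Qed.

Definition fint p (f : fps) := forall n, f n \in Zloc p.

Section Fint.
Variable p : nat.

Lemma fint1 : fint p 1. Proof. by move=> n; rewrite fps_coef1 rpred_nat. Qed.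
Lemma fintM f g : fint p f -> fint p g -> fint p (f * g).
Proof. by move=> fZ gZ n; rewrite fps_coefM rpred_sum // => i _; apply: rpredM. Qed.
Lemma fintX f k : fint p f -> fint p (f ^+ k).
Proof. by move=> fZ; elim: k => [|k IH]; rewrite ?exprS ?expr0; [exact: fint1 | exact: fintM]. Qed.

(** A power series with constant coefficient 1 is invertible, so that dividing by
    it preserves divisibility by [c] of all coefficients. *)
Lemma fint_divl c (u f : fps) : fint p u -> u 0%N = 1 ->
  (forall n, (u * f) n / c \in Zloc p) -> forall n, f n / c \in Zloc p.
Proof.
move=> uZ u0 ufZ; elim/ltn_ind=> n IH.
have := ufZ n; rewrite [u * f]mulrC fps_coefM_recr u0 mulr1 mulrDl mulr_suml => h.
rewrite -[f n / c](addKr (\sum_(i < n) f i * u (n - i)%N / c)) rpredD // rpredN rpred_sum // => i _.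
by rewrite mulrAC rpredM ?IH.
Qed.

End Fint.

(** The power series f(z^p). *)
Definition fps_subst p (f : fps) : fps := fun n => if (p %| n)%N then f (n %/ p)%N else 0.

Section Subst.
Variable p : nat.
Hypothesis p_gt0 : (0 < p)%N.

Lemma fps_coef_subst (f : fps) v n : (v < p)%N ->
  fps_subst p f (v + p * n)%N = if v == 0%N then f n else 0.
Proof.
move=> vp; rewrite /fps_subst dvdn_addl ?dvdn_mulr //.
case: eqP => [->|/eqP v0]; first by rewrite dvdn0 add0n mulKn.
by rewrite gtnNdvd // lt0n.
Qed.

Lemma fps_subst0 (f : fps) : fps_subst p f 0%N = f 0%N.
Proof. by rewrite /fps_subst dvdn0 div0n. Qed.

Lemma fps_coef_substM (f g : fps) v n : (v < p)%N ->
  (fps_subst p g * f) (v + p * n)%N = \sum_(0 <= l < n.+1) g l * f (v + p * (n - l))%N.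
Proof.
move=> vp; rewrite fps_coefM -(big_mkord xpredT (fun i => fps_subst p g i * f (v + p * n - i)%N)).
rewrite (sum_digits n vp) (big_ltn p_gt0).
have sum0 (H : nat -> rat) : (forall u, (0 < u < p)%N -> H u = 0) -> \sum_(1 <= u < p) H u = 0.
  by move=> H0; rewrite big_nat_cond big1 // => u /andP[/H0].
rewrite sum0; last first.
  move=> u /andP[u0 up]; rewrite big1 // => i _.
  by rewrite fps_coef_subst // gtn_eqF // mul0r.
rewrite addr0.
rewrite /ndigits addn1; apply: eq_big_nat => l /andP[_ ln].
by rewrite fps_coef_subst //= add0n mulnBr addnBA // leq_mul2l orbC -ltnS ln.
Qed.

Lemma fps_substM (f g : fps) : fps_subst p (f * g) = fps_subst p f * fps_subst p g.
Proof.
apply: fpsP => N; rewrite (divn_eq N p) mulnC addnC; set v := (N %% p)%N.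
have vp : (v < p)%N by rewrite ltn_mod.
rewrite fps_coef_subst // fps_coef_substM //; case: (eqVneq v 0%N) => v0.
  by rewrite fps_coefM big_mkord; apply: eq_bigr => l _; rewrite fps_coef_subst // v0.
by rewrite big1 // => l _; rewrite fps_coef_subst // (negPf v0) mulr0.
Qed.

Lemma fps_substD (f g : fps) : fps_subst p (f + g) = fps_subst p f + fps_subst p g.
Proof. by apply: fpsP => n; rewrite fps_coefD /fps_subst; case: ifP; rewrite ?fps_coefD ?addr0. Qed.

Lemma fint_subst q f : fint q f -> fint q (fps_subst p f).
Proof. by move=> fZ n; rewrite /fps_subst; case: ifP => _; rewrite ?rpred0. Qed.

End Subst.

Definition Gratio a1 a2 : fps := fps_div (Gseries a1 a2) (Fseries a1 a2).

Lemma Fseries0 a1 a2 : Fseries a1 a2 0%N = 1.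
Proof. by rewrite FseriesE /rising !big_ord0 fact0 divr1 mulr1. Qed.

Lemma Gseries0 a1 a2 : Gseries a1 a2 0%N = 0.
Proof. by rewrite GseriesE /log_coef /harm !big_geq // subr0 addr0 mulr0. Qed.

Lemma GratioE a1 a2 : Fseries a1 a2 * Gratio a1 a2 = Gseries a1 a2.
Proof. by apply: fps_divK; rewrite Fseries0 oner_eq0. Qed.

Lemma Gratio0 a1 a2 : Gratio a1 a2 0%N = 0.
Proof. by have := congr1 (fun f : fps => f 0%N) (GratioE a1 a2); rewrite fps_coefM0 Fseries0 mul1r Gseries0. Qed.

Section Prime.
Variable p : nat.
Hypothesis pr_p : prime p.

Let p_gt0 : (0 < p)%N := prime_gt0 pr_p.
Let p0 : p%:R != 0 :> rat.
Proof. by rewrite pnatr_eq0 -lt0n. Qed.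

Variables (a1 a1' a2 a2' : rat) (t1 t2 : nat).
Hypotheses (d1 : dwork_prime p a1 a1' t1) (d2 : dwork_prime p a2 a2' t2).

(** Collecting the terms of index congruent to v modulo p gives a convolution of
    F', G' and Phi_v; reversing half of it shows the antisymmetric form to which
    [Gseries_lip_sum] applies, with one factor p to spare. *)
Lemma dwork_cross n :
  (fps_subst p (Gseries a1' a2') * Fseries a1 a2 -
   p%:R * (fps_subst p (Fseries a1' a2') * Gseries a1 a2)) n / p%:R \in Zloc p.
Proof.
have [_ a1Z a1'Z a1_gt0 _] := d1; have [_ a2Z a2'Z a2_gt0 _] := d2.
have a1'_gt0 := dwork_prime_gt0 pr_p d1; have a2'_gt0 := dwork_prime_gt0 pr_p d2.
rewrite (divn_eq n p) mulnC addnC; set v := (n %% p)%N; set m := (n %/ p)%N.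
have vp : (v < p)%N by rewrite ltn_mod.
rewrite fps_coefD fps_coefN fps_coef_natM !fps_coef_substM // mulrBl mulrAC divff // mul1r.
pose A' i := Fseries a1' a2' i; pose h i := log_coef a1' a2' i.
pose Phi i := frob_ratio2 p a1 a2 t1 t2 v i.
have FE i : Fseries a1 a2 (v + p * i)%N = A' i * Phi i := Fseries_frob pr_p d1 d2 i vp.
pose main := \sum_(0 <= l < m.+1) A' l * A' (m - l)%N * Phi (m - l)%N * (h l - h (m - l)%N) / p%:R.
suff mainZ : main \in Zloc p.
  rewrite -[X in X \in _](subrK main); apply: rpredD => //.
  rewrite mulr_suml /main -!sumrB big_nat_cond; apply: rpred_sum => l _.
  have GF := Gseries_frob pr_p d1 d2 (m - l)%N vp.
  have A'Z : A' l \in Zloc p by exact: Fseries_Zloc.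
  apply: eq_mem_Zloc (rpredM (rpredNr A'Z) GF) _.
  by rewrite GseriesE FE -/(A' _) -/(h _) -/(h (m - l)%N); field.
have -> : main = \sum_(0 <= l < m.+1) A' l * h l * A' (m - l)%N *
     (- Phi l / p%:R - - Phi (m - l)%N / p%:R).
  pose c l := A' l * A' (m - l)%N / p%:R.
  transitivity (\sum_(0 <= l < m.+1) c l * Phi (m - l)%N * h l -
                \sum_(0 <= l < m.+1) c l * Phi (m - l)%N * h (m - l)%N).
    by rewrite /main -sumrB; apply: eq_bigr => l _; rewrite /c; field.
  rewrite -[X in _ - X]sum_rev -sumrB; apply: eq_big_nat => l lm.
  rewrite /c subSS subKn; last by case/andP: lm.
  by field.
have lipPhi : lip p 1 m.+1 (fun l => - Phi l / p%:R).
  apply: lip_div => x y xm ym; apply: congN.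
  exact: (frob_ratio2_lip pr_p d1 d2 vp xm ym).
have := Gseries_lip_sum pr_p a1'Z a1'_gt0 a2'Z a2'_gt0 lipPhi.
rewrite (eq_bigr (fun l => A' l * h l * A' (m - l)%N *
     (- Phi l / p%:R - - Phi (m - l)%N / p%:R))) // => l _.
by rewrite GseriesE subSS.
Qed.

Theorem dwork_congruence n :
  cong p p%:R (fps_subst p (Gratio a1' a2') n) (p%:R * Gratio a1 a2 n).
Proof.
have [_ a1Z a1'Z a1_gt0 _] := d1; have [_ a2Z a2'Z a2_gt0 _] := d2.
have a1'_gt0 := dwork_prime_gt0 pr_p d1; have a2'_gt0 := dwork_prime_gt0 pr_p d2.
pose u : fps := Fseries a1 a2 * fps_subst p (Fseries a1' a2').
pose f : fps := fps_subst p (Gratio a1' a2') - p%:R * Gratio a1 a2.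
suff : f n / p%:R \in Zloc p by rewrite /cong /f fps_coefD fps_coefN fps_coef_natM.
apply: (@fint_divl p p%:R u f).
- by apply: fintM; last apply: fint_subst; move=> k; exact: Fseries_Zloc.
- by rewrite /u fps_coefM0 fps_subst0 // !Fseries0 mulr1.
move=> k; have := dwork_cross k; rewrite -!GratioE fps_substM //.
by rewrite (_ : _ - _ = u * f) // /u /f; ring.
Qed.

End Prime.

(** * Exponentials of power series *)

(** The derivation z d/dz. *)
Definition theta (f : fps) : fps := fun n => n%:R * f n.

Lemma thetaD f g : theta (f + g) = theta f + theta g.
Proof. by apply: fpsP => n; rewrite fps_coefD /theta -mulrDr. Qed.

Lemma thetaN f : theta (- f) = - theta f.
Proof. by apply: fpsP => n; rewrite fps_coefN /theta -mulrN. Qed.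

Lemma thetaM f g : theta (f * g) = theta f * g + f * theta g.
Proof.
apply: fpsP => n; rewrite fps_coefD /theta !fps_coefM mulr_sumr -big_split.
apply: eq_bigr => i _ /=; rewrite natrB; last by rewrite -ltnS.
by ring.
Qed.

Lemma theta1 : theta 1 = 0.
Proof. by apply: fpsP => -[|n]; rewrite /theta ?mul0r // fps_coef1 mulr0. Qed.

Lemma thetaX f k : theta (f ^+ k.+1) = k.+1%:R * f ^+ k * theta f.
Proof.
elim: k => [|k IH]; first by rewrite expr1 expr0 !mul1r.
by rewrite exprS thetaM IH (exprS f k) -[X in X * _ * theta f]natr1; ring.
Qed.

Lemma theta_natM k f : theta (k%:R * f) = k%:R * theta f.
Proof. by apply: fpsP => n; rewrite fps_coef_natM /theta fps_coef_natM; ring. Qed.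

Lemma theta_subst p f : (0 < p)%N -> theta (fps_subst p f) = p%:R * fps_subst p (theta f).
Proof.
move=> p_gt0; apply: fpsP => n; rewrite fps_coef_natM /theta /fps_subst.
case: ifP => [/dvdnP[m ->]|]; last by rewrite !mulr0.
by rewrite mulnK // natrM; ring.
Qed.

(** A logarithmic derivative without constant term determines a power series up
    to its constant coefficient; all the identities on exponentials below follow. *)
Lemma theta_ode_unique (f g u : fps) : u 0%N = 0 -> f 0%N = g 0%N ->
  theta f = f * u -> theta g = g * u -> f = g.
Proof.
move=> u0 fg0 ef eg; apply: fpsP; elim/ltn_ind=> -[|n] // IH.
have n0 : n.+1%:R != 0 :> rat by rewrite pnatr_eq0.
apply: (mulfI n0); rewrite -[LHS]/(theta f n.+1) -[RHS]/(theta g n.+1) ef eg.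
rewrite !fps_coefM_recr u0 !mulr0 !addr0; apply: eq_bigr => i _; rewrite IH //.
Qed.

Lemma fps_expr_eq0 (h : fps) k n : h 0%N = 0 -> (n < k)%N -> (h ^+ k) n = 0.
Proof. by rewrite -fps_powE; exact: fps_pow_eq0. Qed.

Lemma fps_exp_coef (h : fps) n N : h 0%N = 0 -> (n < N)%N ->
  fps_exp h n = \sum_(k < N) (h ^+ k) n / k`!%:R.
Proof.
move=> h0 nN; rewrite /fps_exp.
rewrite (big_ord_widen N (fun k => fps_pow h k n / k`!%:R)) // big_mkcond.
apply: eq_bigr => k _; rewrite fps_powE; case: ifP => // /negbT; rewrite -leqNgt => nk.
by rewrite fps_expr_eq0 // mul0r.
Qed.

Lemma fps_exp0 (h : fps) : fps_exp h 0%N = 1.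
Proof. by rewrite /fps_exp big_ord1 fps_powE expr0 fps_coef1 divr1. Qed.

Lemma theta_exp (h : fps) : h 0%N = 0 -> theta (fps_exp h) = fps_exp h * theta h.
Proof.
move=> h0; apply: fpsP => n; rewrite /theta (fps_exp_coef (N := n.+1)) // big_ord_recl mulrDr.
rewrite expr0 fps_coef1 mulr_sumr.
have -> : n%:R * ((n == 0%N)%:R / 0`!%:R) = 0 :> rat.
  by case: n => [|n]; rewrite ?mul0r // mulr0.
rewrite add0r fps_coefM.
transitivity (\sum_(k < n) (h ^+ k * theta h) n / k`!%:R).
  apply: eq_bigr => k _; rewrite lift0 mulrA.
  rewrite -[n%:R * _]/(theta (h ^+ k.+1) n) thetaX -mulrA fps_coef_natM factS natrM.
  by rewrite -mulf_div divff ?pnatr_eq0 // mul1r.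
under [RHS]eq_bigr => i _.
  rewrite (fps_exp_coef (N := n.+1)) // mulr_suml.
  over.
rewrite exchange_big /= big_ord_recr /= [X in _ = _ + X]big1 ?addr0; last first.
  move=> i _; have [->|ne] := eqVneq (i : nat) n.
    by rewrite subnn /theta mul0r mulr0.
  by rewrite fps_expr_eq0 ?mul0r //; have := ltn_ord i; lia.
apply: eq_bigr => k _; rewrite fps_coefM mulr_suml; apply: eq_bigr => i _.
by rewrite /theta; ring.
Qed.

Lemma fps_expD (h g : fps) : h 0%N = 0 -> g 0%N = 0 ->
  fps_exp (h + g) = fps_exp h * fps_exp g.
Proof.
move=> h0 g0; apply: (@theta_ode_unique _ _ (theta (h + g))).
- by rewrite /theta mul0r.
- by rewrite fps_coefM0 !fps_exp0 mulr1.
- by rewrite theta_exp // fps_coefD h0 g0 addr0.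
- by rewrite thetaM !theta_exp // thetaD; ring.
Qed.

Lemma fps_exp_natM k (h : fps) : h 0%N = 0 -> fps_exp (k%:R * h) = fps_exp h ^+ k.
Proof.
move=> h0; apply: (@theta_ode_unique _ _ (theta (k%:R * h))).
- by rewrite /theta mul0r.
- by rewrite fps_coefX0 !fps_exp0 expr1n.
- by rewrite theta_exp // fps_coef_natM h0 mulr0.
- case: k => [|k]; first by rewrite mul0r expr0 theta1 mul1r; apply: fpsP => n; rewrite /theta mulr0.
  by rewrite thetaX theta_exp // theta_natM exprS; ring.
Qed.

Lemma fps_exp_subst p (h : fps) : (0 < p)%N -> h 0%N = 0 ->
  fps_exp (fps_subst p h) = fps_subst p (fps_exp h).
Proof.
move=> p_gt0 h0; apply: (@theta_ode_unique _ _ (theta (fps_subst p h))).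
- by rewrite /theta mul0r.
- by rewrite fps_subst0 !fps_exp0.
- by rewrite theta_exp // fps_subst0.
- by rewrite !theta_subst // theta_exp // fps_substM //; ring.
Qed.

Section Prime.
Variable p : nat.
Hypothesis pr_p : prime p.

Let p_gt0 : (0 < p)%N := prime_gt0 pr_p.
Let p_gt1 : (1 < p)%N := prime_gt1 pr_p.
Let p0 : p%:R != 0 :> rat.
Proof. by rewrite pnatr_eq0 -lt0n. Qed.

(** The valuation of k! is less than k: by induction, since the multiples of p up
    to k contribute p^m m! with m the quotient of k by p. *)
Lemma fact_Zloc k : (0 < k)%N -> p%:R ^+ k.-1 / k`!%:R \in Zloc p.
Proof.
elim/ltn_ind: k => k IH k_gt0; set m := (k %/ p)%N; set v := (k %% p)%N.
have vp : (v < p)%N by rewrite ltn_mod.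
have kE : k = (v + p * m)%N by rewrite addnC mulnC -divn_eq.
have mk : (m < k)%N by rewrite ltn_Pdiv.
have UV := unit_risingV pr_p vp m.
have U0 := unit_rising1_neq0 p v m.
have -> : k`!%:R = p%:R ^+ m * m`!%:R * unit_rising p 1 p.-1 v m :> rat.
  by rewrite -!rising1 {1}kE (rising_digits (dwork_prime1 pr_p)).
have m_fact : m`!%:R != 0 :> rat by rewrite pnatr_eq0 -lt0n fact_gt0.
have [m0|m_gt0] := posnP m.
  rewrite m0 expr0 fact0 !mul1r; apply: rpredM; first by rewrite rpredX ?rpred_nat.
  by rewrite -m0.
have -> : p%:R ^+ k.-1 / (p%:R ^+ m * m`!%:R * unit_rising p 1 p.-1 v m) =
    p%:R ^+ (k - m.*2) * (p%:R ^+ m.-1 / m`!%:R) / unit_rising p 1 p.-1 v m.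
  have -> : k.-1 = ((k - m.*2) + m + m.-1)%N.
    by have := leq_mul2r m 2 p; rewrite p_gt1 orbT; lia.
  by rewrite !exprD; field; rewrite U0 m_fact expf_neq0.
by apply: rpredM => //; apply: rpredM; rewrite ?rpredX ?rpred_nat ?IH.
Qed.

Definition pcong (f g : fps) := forall n, cong p p%:R (f n) (g n).

Lemma exp_pint (h : fps) : h 0%N = 0 -> (forall n, h n / p%:R \in Zloc p) ->
  pcong (fps_exp h) 1.
Proof.
move=> h0 hZ n; pose u : fps := fun n => h n / p%:R.
have hE : h = p%:R * u by apply: fpsP => k; rewrite fps_coef_natM /u; field.
have hXE k : h ^+ k = (p ^ k)%:R * u ^+ k by rewrite hE exprMn natrX.
rewrite /fps_exp big_ord_recl fps_powE expr0 fact0 divr1 /cong addrC addKr mulr_suml.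
apply: rpred_sum => k _; rewrite lift0 fps_powE hXE fps_coef_natM natrX.
have uZ : fint p u by [].
apply: eq_mem_Zloc (rpredM (fact_Zloc (ltn0Sn k)) (fintX k.+1 uZ n)) _.
by rewrite exprS /=; field; rewrite p0 pnatr_eq0 -lt0n fact_gt0.
Qed.

End Prime.

(** * The Dieudonne-Dwork criterion *)

Section Prime.
Variable p : nat.
Hypothesis pr_p : prime p.

Let p_gt0 : (0 < p)%N := prime_gt0 pr_p.
Let p_gt1 : (1 < p)%N := prime_gt1 pr_p.
Let p0 : p%:R != 0 :> rat.
Proof. by rewrite pnatr_eq0 -lt0n. Qed.

Lemma expp_cong c : c \in Zloc p -> cong p p%:R (c ^+ p) c.
Proof.
move=> cZ; have [k ck] := Zloc_approx pr_p p_gt0 cZ.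
have cXk m : cong p p%:R (c ^+ m) (k%:R ^+ m).
  elim: m => [|m IH]; first exact: cong_refl.
  by rewrite !exprS; apply: congM; rewrite ?rpred_nat ?rpredX.
apply: cong_trans (cXk p) (cong_trans _ (cong_sym ck)).
by rewrite -natrX; apply: cong_nat => //; rewrite fermat_little.
Qed.

Lemma pcong_frobD f g : fint p f -> fint p g -> pcong p ((f + g) ^+ p) (f ^+ p + g ^+ p).
Proof.
move=> fZ gZ n.
rewrite exprDn -(big_mkord xpredT (fun i => f ^+ (p - i) * g ^+ i *+ 'C(p, i))).
rewrite big_nat_recr //= (big_ltn p_gt0) subn0 subnn !expr0 mulr1 mul1r bin0 binn !mulr1n.
set S := \sum_(1 <= i < p) _; suff SZ : S n / p%:R \in Zloc p.
  by rewrite /cong !fps_coefD (_ : _ + S n + _ - _ = S n) //; ring.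
rewrite /S big_nat_cond; elim/big_rec: _ => [|i h /andP[/andP[i0 ip] _] IH].
  by rewrite fps_coef0 mul0r rpred0.
rewrite fps_coefD mulrDl rpredD // fps_coefMn.
have /dvdnP[c ->] : (p %| 'C(p, i))%N by apply: prime_dvd_bin; rewrite ?i0.
rewrite mulrnA -[X in X / _]mulr_natr mulfK // rpredMn //.
by apply: fintM; exact: fintX.
Qed.

Lemma fint_lowZ (f : fps) N : fint p f -> fint p (fun n => if (n < N)%N then f n else 0).
Proof. by move=> fZ n; case: ifP; rewrite ?rpred0. Qed.

(** For polynomials, by induction on the number of terms, from Fermat's little
    theorem for the coefficients. *)
Lemma poly_frob N f : fint p f -> (forall n, (N <= n)%N -> f n = 0) ->
  pcong p (f ^+ p) (fps_subst p f).
Proof.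
elim: N f => [|N IH] f fZ fN.
  have -> : f = 0 by apply: fpsP => n; rewrite fN.
  move=> n; rewrite expr0n gtn_eqF //= /fps_subst; case: ifP => _; exact: cong_refl.
pose g : fps := fun n => if (n < N)%N then f n else 0.
pose m : fps := fun n => if n == N then f N else 0.
have fgm : f = g + m.
  apply: fpsP => n; rewrite fps_coefD /g /m; case: ltngtP => [nN|nN|->]; rewrite ?addr0 ?add0r //.
  exact: fN.
have gZ : fint p g by exact: fint_lowZ.
have mZ : fint p m by move=> n; rewrite /m; case: ifP; rewrite ?rpred0.
have mX k n : (m ^+ k) n = if n == (N * k)%N then f N ^+ k else 0.
  elim: k n => [|k IHk] n; first by rewrite muln0 !expr0 fps_coef1; case: eqP.
  rewrite exprS fps_coefM; have [Nn|nN] := leqP N n; last first.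
    rewrite big1 => [|i _]; last by rewrite /m ltn_eqF ?mul0r //; have := ltn_ord i; lia.
    by rewrite ltn_eqF // mulnS; lia.
  rewrite (bigD1 (Ordinal (Nn : N < n.+1)%N)) //= {1}/m eqxx IHk big1 ?addr0 => [|i iN].
    have -> : (n - N == N * k)%N = (n == N * k.+1)%N by rewrite mulnS; lia.
    by case: ifP; rewrite ?mulr0 ?exprS.
  by rewrite /m ifN ?mul0r //.
move=> n; rewrite fgm fps_substD // fps_coefD.
apply: cong_trans (pcong_frobD gZ mZ n) _; rewrite fps_coefD; apply: congD.
  by apply: IH => // k; rewrite /g leqNgt => /negPf->.
rewrite mX /fps_subst /m; have [/dvdnP[k ->]|pn] := boolP (p %| n)%N; last first.
  by case: eqP pn => [->|_ _]; [rewrite dvdn_mull | exact: cong_refl].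
rewrite mulnK // eqn_pmul2r //; case: ifP => _; last exact: cong_refl.
exact: expp_cong.
Qed.

Lemma fps_coefM_high (f g : fps) n : (forall i, (i <= n)%N -> f i = 0) -> (f * g) n = 0.
Proof. by move=> f0; rewrite fps_coefM big1 // => i _; rewrite f0 ?mul0r // -ltnS. Qed.

Lemma frob_cong (f : fps) : fint p f -> pcong p (f ^+ p) (fps_subst p f).
Proof.
move=> fZ n; pose T : fps := fun k => if (k < n.+1)%N then f k else 0.
pose D : fps := f - T.
have D0 i : (i <= n)%N -> D i = 0 by move=> ni; rewrite /D fps_coefD fps_coefN /T ltnS ni subrr.
have fX k : (f ^+ k) n = (T ^+ k) n.
  have [R ->] : exists R, f ^+ k = T ^+ k + D * R.
    elim: k => [|k [R e]]; first by exists 0; rewrite mulr0 addr0.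
    exists (f ^+ k + T * R); rewrite !exprS {1}(_ : f = T + D); last by rewrite /D; ring.
    by rewrite mulrDl {1}e; ring.
  by rewrite fps_coefD fps_coefM_high // addr0.
have -> : fps_subst p f n = fps_subst p T n.
  by rewrite /fps_subst /T; case: ifP => // _; rewrite ltnS leq_div.
rewrite fX; apply: (@poly_frob n.+1); first exact: fint_lowZ.
by move=> k nk; rewrite /T ltnNge nk.
Qed.

(** Only the linear term in [D] contributes to the coefficient of degree n. *)
Lemma fps_coefX_pert (T D : fps) k n : (0 < n)%N -> (forall i, (i < n)%N -> D i = 0) ->
  ((T + D) ^+ k.+1) n = (T ^+ k.+1) n + k.+1%:R * T 0%N ^+ k * D n.
Proof.
move=> n_gt0 D0.
have [R ->] : exists R, (T + D) ^+ k.+1 = T ^+ k.+1 + D * (k.+1%:R * T ^+ k) + D * (D * R).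
  elim: k => [|k [R e]]; first by exists 0; rewrite !expr1 expr0 !mulr0; ring.
  exists (k.+1%:R * T ^+ k + (T + D) * R).
  by rewrite exprS e [T ^+ k.+2]exprS (exprS T k) -[k.+2%:R]natr1; ring.
rewrite !fps_coefD !fps_coefM_low // (D0 0%N) // mul0r mulr0 addr0 fps_coefX0.
have -> : (k.+1%:R : fps) 0%N = k.+1%:R by rewrite -[k.+1%:R]mulr1 fps_coef_natM fps_coef1 mulr1.
by rewrite mulrC.
Qed.

Variable w : fps.
Hypothesis w0 : w 0%N = 0.
Let E := fps_exp w.
Let D : fps := p%:R * w - fps_subst p w.

Let D0 : D 0%N = 0.
Proof. by rewrite /D fps_coefD fps_coefN fps_coef_natM fps_subst0 w0 mulr0 subr0. Qed.

Let subw0 : fps_subst p w 0%N = 0. Proof. by rewrite fps_subst0. Qed.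

Lemma exp_frob : E ^+ p = fps_subst p E * fps_exp D.
Proof.
rewrite /E -fps_exp_subst // -fps_exp_natM // -fps_expD //; congr fps_exp; rewrite /D; ring.
Qed.

(** From E^p = E(z^p) exp(D) with D divisible by p, the coefficient n of E^p is known
    modulo p from the coefficients of E below n, while E_n enters it as p E_n.
    The p-th power being E(z^p) modulo p, this forces p E_n to be divisible by p. *)
Theorem dieudonne_dwork : (forall n, cong p p%:R (fps_subst p w n) (p%:R * w n)) -> fint p E.
Proof.
move=> wp; have DZ n : D n / p%:R \in Zloc p.
  by rewrite /D fps_coefD fps_coefN fps_coef_natM; exact: cong_sym (wp n).
have X1 := exp_pint pr_p D0 DZ.
have XZ : fint p (fps_exp D).
  move=> n; rewrite -[X in X \in _](subrK ((1 : fps) n)) rpredD ?fint1 //.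
  by rewrite -[_ - _](divfK p0) rpredM ?rpred_nat // ; exact: X1.
elim/ltn_ind=> n IH; have [->|n_gt0] := posnP n; first by rewrite /E fps_exp0 rpred1.
pose T : fps := fun k => if (k < n)%N then E k else 0.
have TZ : fint p T by move=> k; rewrite /T; case: ifP => [/IH|] //; rewrite rpred0.
pose Del : fps := E - T.
have Del0 i : (i < n)%N -> Del i = 0 by move=> ni; rewrite /Del fps_coefD fps_coefN /T ni subrr.
have TE : T + Del = E by rewrite /Del; ring.
have T0 : T 0%N = 1 by rewrite /T n_gt0 /E fps_exp0.
have Deln : Del n = E n by rewrite /Del fps_coefD fps_coefN /T ltnn subr0.
have := fps_coefX_pert T p.-1 n_gt0 Del0.
rewrite TE prednK // T0 expr1n mulr1 Deln => Epn.
have e1 : (E ^+ p) n = (fps_subst p T * fps_exp D) n.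
  rewrite exp_frob !fps_coefM; apply: eq_bigr => i _; congr (_ * _).
  rewrite /fps_subst /T; case: ifP => // /dvdnP[j ij]; rewrite ij mulnK //.
  case: ifP => // /negbT; rewrite -leqNgt => nj.
  have := ltn_ord i; rewrite ij ltnS => jn.
  have jp : (j < j * p)%N by rewrite ltn_Pmulr //; case: (j) nj n_gt0 => //; lia.
  by move: nj jn jp; clear; lia.
have c1 : cong p p%:R ((E ^+ p) n) (fps_subst p T n).
  have sT := fint_subst p TZ.
  rewrite e1 -[fps_subst p T in X in cong _ _ _ X]mulr1 !fps_coefM; apply: cong_sum => i _.
  by apply: congM; [exact: sT | exact: XZ | exact: cong_refl | exact: X1].
have c2 := frob_cong TZ n.
have : cong p p%:R (p%:R * E n) 0.
  have -> : p%:R * E n = (E ^+ p) n - (T ^+ p) n by rewrite Epn; ring.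
  rewrite -(subrr (fps_subst p T n)); apply: congD c1 (congN c2).
by rewrite /cong subr0 mulrC mulKf.
Qed.

(** Here E^p = E(z^p) modulo p gives that exp(D) is 1 modulo p, and the coefficients
    of D are recovered one after the other. *)
Theorem dieudonne_dwork_conv : fint p E ->
  forall n, cong p p%:R (fps_subst p w n) (p%:R * w n).
Proof.
move=> EZ; have sE := fint_subst p EZ.
have X1 n : (fps_exp D - 1) n / p%:R \in Zloc p.
  apply: (fint_divl sE) => [|k]; first by rewrite fps_subst0 /E fps_exp0.
  rewrite (_ : _ * _ = E ^+ p - fps_subst p E); last by rewrite exp_frob; ring.
  exact: frob_cong.
suff DZ n : D n / p%:R \in Zloc p.
  by move=> n; apply: cong_sym; have := DZ n; rewrite /D fps_coefD fps_coefN fps_coef_natM.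
elim/ltn_ind: n => n IH; have [->|n_gt0] := posnP n; first by rewrite D0 mul0r rpred0.
pose T : fps := fun k => if (k < n)%N then D k else 0.
have TZ k : T k / p%:R \in Zloc p.
  by rewrite /T; case: ifP => [/IH|] //; rewrite mul0r rpred0.
have T0 : T 0%N = 0 by rewrite /T n_gt0 D0.
pose Del : fps := D - T.
have Del0 i : (i < n)%N -> Del i = 0 by move=> ni; rewrite /Del fps_coefD fps_coefN /T ni subrr.
have Deln : Del n = D n by rewrite /Del fps_coefD fps_coefN /T ltnn subr0.
have Y1 := exp_pint pr_p T0 TZ n.
have eD : fps_exp D n = fps_exp T n + Del n.
  rewrite {1}(_ : D = Del + T); last by rewrite /Del; ring.
  have eDel i : (i <= n)%N -> fps_exp Del i = if i == 0%N then 1 else Del i.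
    case: i => [|i] iN; first by rewrite fps_exp0.
    have i0 : i.+1%:R != 0 :> rat by rewrite pnatr_eq0.
    apply: (mulfI i0); rewrite -[LHS]/(theta (fps_exp Del) i.+1) theta_exp; last exact: Del0.
    rewrite [fps_exp Del * _]mulrC fps_coefM_low; first by rewrite fps_exp0 mulr1.
    by move=> j ji; rewrite /theta Del0 ?mulr0 //; exact: leq_trans ji iN.
  rewrite fps_expD; [|exact: Del0 | exact: T0].
  rewrite (_ : fps_exp Del * _ = fps_exp T + (fps_exp Del - 1) * fps_exp T).
    rewrite fps_coefD fps_coefM_low.
      by rewrite fps_coefD fps_coefN fps_coef1 eDel // gtn_eqF // subr0 fps_exp0 mulr1.
    move=> i iN; rewrite fps_coefD fps_coefN fps_coef1 eDel 1?ltnW //; case: eqP => _; first exact: subrr.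
    by rewrite Del0 // subr0.
  by ring.
have := X1 n; rewrite fps_coefD fps_coefN eD => h.
move: Y1; rewrite /cong => Y1.
apply: eq_mem_Zloc (rpredB h Y1) _.
by rewrite -Deln; ring.
Qed.
End Prime.

(** * Rescaling at finitely many primes *)

Lemma fps_scaleM c (f g : fps) : fps_scale c (f * g) = fps_scale c f * fps_scale c g.
Proof.
apply: fpsP => n; rewrite /fps_scale !fps_coefM mulr_suml; apply: eq_bigr => i _.
have -> : c ^+ n = c ^+ i * c ^+ (n - i) by rewrite -exprD subnKC // -ltnS.
by ring.
Qed.

Lemma fps_scale0 c (f : fps) : fps_scale c f 0%N = f 0%N.
Proof. by rewrite /fps_scale expr0 mulr1. Qed.

Lemma fps_exp_scale c (h : fps) : h 0%N = 0 ->
  fps_exp (fps_scale c h) = fps_scale c (fps_exp h).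
Proof.
have theta_scale f : theta (fps_scale c f) = fps_scale c (theta f).
  by apply: fpsP => n; rewrite /theta /fps_scale mulrA.
move=> h0; apply: (@theta_ode_unique _ _ (theta (fps_scale c h))).
- by rewrite /theta mul0r.
- by rewrite fps_scale0 !fps_exp0.
- by rewrite theta_exp // fps_scale0.
- by rewrite !theta_scale theta_exp // fps_scaleM.
Qed.

Lemma fps_scale_comp c d (f : fps) : fps_scale c (fps_scale d f) = fps_scale (d * c) f.
Proof. by apply: fpsP => n; rewrite /fps_scale exprMn mulrA. Qed.

Lemma fint_scale p k f : fint p f -> fint p (fps_scale k%:R f).
Proof. by move=> fZ n; rewrite /fps_scale rpredM ?rpredX ?rpred_nat. Qed.

Section Prime.
Variable p : nat.
Hypothesis pr_p : prime p.

Let p_gt0 : (0 < p)%N := prime_gt0 pr_p.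
Let p0 : p%:R != 0 :> rat.
Proof. by rewrite pnatr_eq0 -lt0n. Qed.

Lemma pmul_Zloc (a : rat) : exists e : nat, a * p%:R ^+ e \in Zloc p.
Proof.
have d0 : (0 < `|denq a|)%N by rewrite absz_gt0 denq_eq0.
have [m cm dE] := p_part pr_p d0; exists (logn p `|denq a|).
apply/ZlocP; exists m => //; rewrite -mulrA -natrX -natrM mulnC -dE.
have -> : (`|denq a|%N)%:R = (denq a)%:~R :> rat.
  by rewrite -[in RHS](gez0_abs (ltW (denq_gt0 a))).
by rewrite -numqE intr_int.
Qed.

Lemma fact_pZloc n : p%:R ^+ n / n`!%:R \in Zloc p.
Proof.
case: n => [|n]; first by rewrite expr0 fact0 divr1 rpred1.
by rewrite exprS -mulrA rpredM ?rpred_nat //; exact: (fact_Zloc pr_p (ltn0Sn n)).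
Qed.

Lemma rising_pZloc a e n : a * p%:R ^+ e \in Zloc p ->
  rising a n * p%:R ^+ (e * n) \in Zloc p.
Proof.
move=> aZ; rewrite exprM risingE; elim: n => [|n IH].
  by rewrite big_geq // mul1r rpred1.
rewrite big_nat_recr //= exprSr mulrACA rpredM // mulrDl rpredD // rpredM ?rpredX ?rpred_nat //.
Qed.

Lemma rising_harm_pZloc a e n : 0 < a -> a * p%:R ^+ e \in Zloc p ->
  rising a n * harm a n * p%:R ^+ (e * n) \in Zloc p.
Proof.
move=> a0 aZ; elim: n => [|n IH]; first by rewrite /harm big_geq // mulr0 mul0r rpred0.
have an : a + n%:R != 0 by rewrite gt_eqF // ltr_wpDr ?ler0n.
have -> : rising a n.+1 * harm a n.+1 * p%:R ^+ (e * n.+1) =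
   (rising a n * harm a n * p%:R ^+ (e * n)) * ((a + n%:R) * p%:R ^+ e) +
   (rising a n * p%:R ^+ (e * n)) * p%:R ^+ e.
  rewrite risingE /harm !big_nat_recr //= -risingE -/(harm a n) mulnS exprD; field => //.
rewrite rpredD // rpredM ?rising_pZloc ?rpredX ?rpred_nat //.
by rewrite mulrDl rpredD // rpredM ?rpredX ?rpred_nat.
Qed.

Lemma harm1_pZloc n : harm 1 n * p%:R ^+ n \in Zloc p.
Proof.
elim: n => [|n IH]; first by rewrite /harm big_geq // mul0r rpred0.
rewrite /harm big_nat_recr //= -/(harm 1 n) mulrDl rpredD //.
  by rewrite exprSr mulrA rpredM ?rpred_nat.
have -> : (1 + n%:R)^-1 * p%:R ^+ n.+1 = (p%:R ^+ n / n.+1`!%:R) * n`!%:R * p%:R :> rat.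
  have n1 : 1 + n%:R != 0 :> rat by rewrite nat1r pnatr_eq0.
  by rewrite factS natrM -nat1r exprSr; field; rewrite n1 pnatr_eq0 -lt0n fact_gt0.
by rewrite rpredM ?rpred_nat // rpredM ?rpred_nat //; exact: (fact_Zloc pr_p (ltn0Sn n)).
Qed.

(** The denominators of the coefficients of F and G grow at most geometrically, so
    that some power [c] of p clears them; one more factor p makes w(p c z) divisible
    by p, and its exponential is p-integral. *)
Lemma exp_Gratio_scale a1 a2 : 0 < a1 -> 0 < a2 ->
  exists2 k, (0 < k)%N & fint p (fps_scale k%:R (fps_exp (Gratio a1 a2))).
Proof.
move=> a1_gt0 a2_gt0.
have [e1 a1Z] := pmul_Zloc a1; have [e2 a2Z] := pmul_Zloc a2.
(* e1 and e2 are for the rising factorials, 3 for n!^2 and the harmonic sum *)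
pose e := (e1 + e2 + 3)%N; pose c : rat := p%:R ^+ e.
have cE n : c ^+ n = p%:R ^+ (e1 * n) * p%:R ^+ (e2 * n) * p%:R ^+ n * p%:R ^+ n * p%:R ^+ n.
  by rewrite /c -exprM -!exprD; congr (_ ^+ _); rewrite /e; lia.
have fact0' n : n`!%:R != 0 :> rat by rewrite pnatr_eq0 -lt0n fact_gt0.
have h1 n := rising_pZloc n a1Z; have h2 n := rising_pZloc n a2Z.
have pZ n : p%:R ^+ n \in Zloc p by rewrite rpredX ?rpred_nat.
have FZ : fint p (fps_scale c (Fseries a1 a2)).
  move=> n; rewrite /fps_scale cE /Fseries.
  apply: eq_mem_Zloc (rpredM (rpredM (h1 n) (h2 n))
    (rpredM (pZ n) (rpredM (fact_pZloc n) (fact_pZloc n)))) _.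
  by field.
have GZ : fint p (fps_scale c (Gseries a1 a2)).
  move=> n; rewrite /fps_scale cE GseriesE /Fseries /log_coef.
  have g1 := rising_harm_pZloc n a1_gt0 a1Z; have g2 := rising_harm_pZloc n a2_gt0 a2Z.
  have ff := rpredM (fact_pZloc n) (fact_pZloc n).
  have H := rpredM (rpredM (h1 n) (h2 n)) (rpredM (harm1_pZloc n) ff).
  have K1 := rpredM (rpredM g1 (h2 n)) (rpredM (pZ n) ff).
  have K2 := rpredM (rpredM (h1 n) g2) (rpredM (pZ n) ff).
  apply: eq_mem_Zloc (rpredD (rpredB K1 H) (rpredB K2 H)) _.
  by field.
have wZ : fint p (fps_scale c (Gratio a1 a2)).
  move=> n; rewrite -[X in X \in _]divr1.
  apply: (fint_divl FZ) n => [|n]; first by rewrite fps_scale0 Fseries0.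
  by rewrite -fps_scaleM GratioE divr1.
exists (p ^ e.+1)%N; first by rewrite expn_gt0 p_gt0.
rewrite -fps_exp_scale ?Gratio0 // natrX exprS mulrC -/c -fps_scale_comp.
have := exp_pint pr_p (h := fps_scale p%:R (fps_scale c (Gratio a1 a2))).
rewrite !fps_scale0 Gratio0 => /(_ erefl) int1 n.
rewrite -[X in X \in _](subrK ((1 : fps) n)) rpredD ?fint1 // -[_ - _](divfK p0).
rewrite rpredM ?rpred_nat //; apply: int1 => -[|k]; first by rewrite !fps_scale0 Gratio0 mul0r rpred0.
by rewrite {1}/fps_scale exprSr mulrA mulfK // rpredM.
Qed.

End Prime.

Lemma exp_Gratio_scale_upto a1 a2 B : 0 < a1 -> 0 < a2 ->
  exists2 k, (0 < k)%N & forall p, prime p -> (p < B)%N ->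
    fint p (fps_scale k%:R (fps_exp (Gratio a1 a2))).
Proof.
move=> a1_gt0 a2_gt0; elim: B => [|B [k k0 IH]]; first by exists 1%N.
have [pB|npB] := boolP (prime B); last first.
  exists k => // p pr_p; rewrite ltnS leq_eqVlt => /orP[/eqP pE|]; last exact: IH.
  by rewrite -pE pr_p in npB.
have [m m0 mB] := exp_Gratio_scale pB a1_gt0 a2_gt0.
exists (k * m)%N; first by rewrite muln_gt0 k0.
move=> p pr_p; rewrite ltnS leq_eqVlt natrM => /orP[/eqP->|pB'].
  by rewrite mulrC -fps_scale_comp; exact: fint_scale.
by rewrite -fps_scale_comp; apply: fint_scale; exact: IH.
Qed.

(** * The differential equation and the symmetry a -> 1 - a *)

Definition fpsC (c : rat) : fps := fun n => if n is 0%N then c else 0.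

Lemma coef_fpsC_mul c (f : fps) n : (fpsC c * f) n = c * f n.
Proof.
rewrite fps_coefM big_ord_recl subn0 big1 ?addr0 // => i _.
by rewrite lift0 mul0r.
Qed.

Lemma theta_fpsC c f : theta (fpsC c * f) = fpsC c * theta f.
Proof. by apply: fpsP => n; rewrite coef_fpsC_mul /theta coef_fpsC_mul; ring. Qed.

Lemma fpsCB c d : fpsC (c - d) = fpsC c - fpsC d.
Proof. by apply: fpsP => -[|n]; rewrite fps_coefD fps_coefN //= subr0. Qed.

Lemma fpsC1 : fpsC 1 = 1.
Proof. by apply: fpsP => -[|n]. Qed.

(** The power series z, z / (1 - z) and - log (1 - z). *)
Definition fps_z : fps := fun n => (n == 1%N)%:R.
Definition fps_geom : fps := fun n => (n != 0%N)%:R.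
Definition fps_log : fps := fun n => n%:R^-1.

Lemma fps_coef_zM (f : fps) n : (fps_z * f) n = if n is k.+1 then f k else 0.
Proof.
case: n => [|n]; first by rewrite fps_coefM0 /fps_z mul0r.
rewrite fps_coefM !big_ord_recl /= big1 => [|i _].
  by rewrite /fps_z mul0r add0r mul1r addr0 subn1.
by rewrite /fps_z mul0r.
Qed.

Lemma geom_zE : (1 + fps_geom) * fps_z = fps_geom.
Proof.
by apply: fpsP => -[|n]; rewrite mulrC fps_coef_zM // fps_coefD fps_coef1 /fps_geom; case: n => [|n]; rewrite ?addr0 ?add0r.
Qed.

(** The equation reads (1 - z) f = z k. *)
Lemma geom_solve (f k : fps) : f = fps_z * (f + k) -> f = fps_geom * k.
Proof.
move=> e; have {}e : (1 - fps_z) * f = fps_z * k.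
  by rewrite mulrBl mul1r {1}e mulrDr addrAC subrr add0r.
have inv : (1 + fps_geom) * (1 - fps_z) = 1 by rewrite mulrBr mulr1 geom_zE addrK.
by rewrite -[LHS]mul1r -inv -mulrA e mulrA geom_zE.
Qed.

Lemma theta_log : theta fps_log = fps_geom.
Proof.
apply: fpsP => -[|n]; rewrite /theta /fps_log /fps_geom ?mul0r //.
by rewrite divff ?pnatr_eq0.
Qed.

Lemma theta_geom : theta fps_geom = fps_geom + fps_geom ^+ 2.
Proof.
have th_z : theta fps_z = fps_z.
  by apply: fpsP => -[|[|n]]; rewrite /theta /fps_z ?mul0r ?mul1r ?mulr0.
have := congr1 theta geom_zE; rewrite thetaM thetaD theta1 th_z add0r => e.
rewrite [LHS](@geom_solve _ (1 + fps_geom)); first by ring.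
by rewrite -{1}e; ring.
Qed.

(** The equations below are those of F and of F log z + G, divided by 1 - z. *)
Section ODE.
Variables a1 a2 : rat.
Let F := Fseries a1 a2.
Let G := Gseries a1 a2.
Let X := fps_geom.
Let s := fpsC ((a1 + a2) / 2).
Let e := fpsC (a1 * a2).

Lemma rising_S a k : rising a k.+1 = rising a k * (a + k%:R).
Proof. by rewrite /rising big_ord_recr. Qed.

Lemma Fseries_S n : n.+1%:R ^+ 2 * F n.+1 = (a1 + n%:R) * (a2 + n%:R) * F n.
Proof.
rewrite /F /Fseries !rising_S factS natrM.
have n1 : n.+1%:R != 0 :> rat by rewrite pnatr_eq0.
have nf : n`!%:R != 0 :> rat by rewrite pnatr_eq0 -lt0n fact_gt0.
by move: n.+1%:R n1 => y n1; field; rewrite n1 nf.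
Qed.

Hypotheses (a1_gt0 : 0 < a1) (a2_gt0 : 0 < a2).

Lemma Gseries_S n : n.+1%:R ^+ 2 * G n.+1 + 2 * n.+1%:R * F n.+1 =
  (a1 + n%:R) * (a2 + n%:R) * G n + (a1 + a2 + 2 * n%:R) * F n.
Proof.
rewrite /G !GseriesE -/F.
have n1 : n.+1%:R != 0 :> rat by rewrite pnatr_eq0.
have an1 : a1 + n%:R != 0 by rewrite gt_eqF // ltr_wpDr ?ler0n.
have an2 : a2 + n%:R != 0 by rewrite gt_eqF // ltr_wpDr ?ler0n.
have -> : log_coef a1 a2 n.+1 =
   log_coef a1 a2 n + (a1 + n%:R)^-1 + (a2 + n%:R)^-1 - 2 / n.+1%:R.
  by rewrite /log_coef /harm !big_nat_recr //= nat1r; ring.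
have -> : F n.+1 = (a1 + n%:R) * (a2 + n%:R) * F n / n.+1%:R ^+ 2.
  by rewrite -Fseries_S mulrC mulKf // expf_neq0.
by move: n.+1%:R n1 => y n1; field; rewrite n1 an1 an2.
Qed.

Lemma theta2_F : theta (theta F) = X * (2%:R * s * theta F + e * F).
Proof.
have eZ : theta (theta F) = fps_z * (theta (theta F) + (2%:R * s * theta F + e * F)).
  apply: fpsP => -[|n]; first by rewrite fps_coef_zM /theta mul0r.
  rewrite fps_coef_zM !fps_coefD -mulrA fps_coef_natM !coef_fpsC_mul /theta.
  by rewrite mulrA -expr2 Fseries_S; field.
exact: (geom_solve eZ).
Qed.

Lemma theta2_G : theta (theta G) + 2%:R * theta F =
  X * (2%:R * s * theta G + e * G + 2%:R * s * F).
Proof.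
have eZ : theta (theta G) + 2%:R * theta F = fps_z * (theta (theta G) + 2%:R * theta F +
    (2%:R * s * theta G + e * G + 2%:R * s * F)).
  apply: fpsP => -[|n].
    by rewrite fps_coef_zM fps_coefD fps_coef_natM /theta !mul0r mulr0 addr0.
  rewrite fps_coef_zM !fps_coefD -![2%:R * s * _]mulrA !fps_coef_natM !coef_fpsC_mul /theta.
  rewrite [n.+1%:R * (_ * _)]mulrA -expr2 [2 * (_ * F n.+1)]mulrA Gseries_S.
  by field.
exact: (geom_solve eZ).
Qed.

Let R := fps_exp (- (s * fps_log)).
Let y := F * R.
Let w := Gratio a1 a2.

Let theta_R : theta R = - s * X * R.
Proof.
rewrite /R theta_exp; last by rewrite fps_coefN coef_fpsC_mul /fps_log invr0 mulr0 oppr0.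
by rewrite thetaN theta_fpsC theta_log -/X -/R -/s; ring.
Qed.

(** With R = (1 - z)^s, where s is half the sum of the parameters, y = F R
    satisfies an equation without first order term. *)
Lemma theta2_y : theta (theta y) = y * ((e - s) * X + (s ^+ 2 - s) * X ^+ 2).
Proof.
have theta_y : theta y = theta F * R - s * (X * y).
  by rewrite /y thetaM theta_R; ring.
rewrite theta_y thetaD thetaN theta_fpsC !thetaM theta_R theta_geom theta2_F -/X -/s.
by rewrite /y; ring.
Qed.

(** The derivative of the left-hand side vanishes by the equations of F and G. *)
Lemma wronskian : (1 + theta w) * y ^+ 2 = 1.
Proof.
have : F * w = G := GratioE a1 a2.
move: w => v wF.
have t2w : F * theta (theta v) + 2%:R * (1 + theta v) * theta F = 2%:R * s * X * (1 + theta v) * F.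
  have := theta2_G; rewrite -wF !thetaM thetaD !thetaM theta2_F => h.
  apply: (addIr (v * (X * (2%:R * s * theta F + e * F)))).
  transitivity (X * (2%:R * s * theta F + e * F) * v + theta F * theta v +
    (theta F * theta v + F * theta (theta v)) + 2%:R * theta F).
    by ring.
  by rewrite h; ring.
have y0 : y 0%N = 1 by rewrite /y fps_coefM0 /F Fseries0 /R fps_exp0 mulr1.
apply: (@theta_ode_unique _ _ 0) => //.
- by rewrite fps_coefM0 expr2 fps_coefM0 y0 fps_coefD /theta mul0r fps_coef1.
- rewrite mulr0 expr2 !thetaM thetaD theta1 add0r theta_R /y.
  transitivity (F * R * R * (F * theta (theta v) + 2%:R * (1 + theta v) * theta F -
                2%:R * s * X * (1 + theta v) * F)); first by ring.
  by rewrite t2w subrr mulr0.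
- by rewrite theta1 mulr0.
Qed.

End ODE.

(** Both e - s and s^2 - s are unchanged when a1 and a2 are replaced by 1 - a1 and
    1 - a2, hence so is y by its differential equation, and w by the Wronskian. *)
Lemma Gratio_compl a1 a2 : 0 < a1 < 1 -> 0 < a2 < 1 ->
  Gratio (1 - a1) (1 - a2) = Gratio a1 a2.
Proof.
move=> /andP[a1_gt0 a1_lt1] /andP[a2_gt0 a2_lt1].
pose y b1 b2 : fps := Fseries b1 b2 * fps_exp (- (fpsC ((b1 + b2) / 2) * fps_log)).
have y0 b1 b2 : y b1 b2 0%N = 1 by rewrite /y fps_coefM0 Fseries0 fps_exp0 mulr1.
pose Q b1 b2 : fps := (fpsC (b1 * b2) - fpsC ((b1 + b2) / 2)) * fps_geom +
  (fpsC ((b1 + b2) / 2) ^+ 2 - fpsC ((b1 + b2) / 2)) * fps_geom ^+ 2.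
have Q0 b1 b2 : Q b1 b2 0%N = 0.
  have g0 : fps_geom 0%N = 0 by [].
  by rewrite /Q fps_coefD !fps_coefM0 ?fps_coefX0 ?g0 ?expr0n ?mulr0 ?addr0.
have QE : Q (1 - a1) (1 - a2) = Q a1 a2.
  have sE : fpsC ((1 - a1 + (1 - a2)) / 2) = 1 - fpsC ((a1 + a2) / 2).
    by rewrite -fpsC1 -fpsCB; congr fpsC; field.
  have eE : fpsC ((1 - a1) * (1 - a2)) = fpsC (a1 * a2) + 1 - fpsC ((a1 + a2) / 2) - fpsC ((a1 + a2) / 2).
    by apply: fpsP => -[|n]; rewrite !fps_coefD !fps_coefN /= ?fps_coef1 /=; [by field | by ring].
  by rewrite /Q sE eE; ring.
have yE : y (1 - a1) (1 - a2) = y a1 a2.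
  have := theta2_y (1 - a1) (1 - a2); rewrite -/(y _ _) -/(Q _ _) QE.
  have := theta2_y a1 a2; rewrite -/(y _ _) -/(Q _ _).
  move: (y0 a1 a2) (y0 (1 - a1) (1 - a2)) (Q0 a1 a2).
  move: (y a1 a2) (y (1 - a1) (1 - a2)) (Q a1 a2) => f g q f0 g0 q0 ef eg.
  apply: fpsP; elim/ltn_ind=> -[_|n IH]; first by rewrite f0.
  have n0 : n.+1%:R != 0 :> rat by rewrite pnatr_eq0.
  apply: (mulfI n0); apply: (mulfI n0).
  rewrite -[LHS]/(theta (theta g) n.+1) -[RHS]/(theta (theta f) n.+1) ef eg.
  by rewrite !fps_coefM_recr q0 !mulr0 !addr0; apply: eq_bigr => i _; rewrite IH.
have W1 := wronskian a1_gt0 a2_gt0.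
have W2 : (1 + theta (Gratio (1 - a1) (1 - a2))) * y (1 - a1) (1 - a2) ^+ 2 = 1.
  by apply: wronskian; rewrite subr_gt0.
have : 1 + theta (Gratio (1 - a1) (1 - a2)) = 1 + theta (Gratio a1 a2).
  apply: (@fps_lreg (y a1 a2 ^+ 2)); first by rewrite fps_coefX0 y0 expr1n oner_eq0.
  by rewrite mulrC -{1}yE W2 mulrC W1.
move/addrI => e; apply: fpsP => -[|n]; first by rewrite !Gratio0.
have n0 : n.+1%:R != 0 :> rat by rewrite pnatr_eq0.
by apply: (mulfI n0); exact: (congr1 (fun f : fps => f n.+1) e).
Qed.

(** * Pairs stable under multiplication by integers modulo Z *)

(** Congruence modulo Z. *)
Definition eqZ (x y : rat) := x - y \is a Num.int.

Lemma eqZ_refl x : eqZ x x. Proof. by rewrite /eqZ subrr rpred0. Qed.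
Lemma eqZ_trans y x z : eqZ x y -> eqZ y z -> eqZ x z.
Proof. by move=> xy yz; rewrite /eqZ -[x](subrK y) -addrA rpredD. Qed.
Lemma eqZ_mul (k x y : rat) : k \is a Num.int -> eqZ x y -> eqZ (k * x) (k * y).
Proof. by move=> kZ xy; rewrite /eqZ -mulrBr rpredM. Qed.

Lemma eqZ_unit_interval x y : 0 < x < 1 -> 0 < y < 1 -> eqZ x y -> x = y.
Proof.
move=> /andP[x0 x1] /andP[y0 y1] /intrP[m e].
have : (m%:~R < 1 :> rat) && (-1 < m%:~R :> rat) by rewrite -e; lra.
rewrite (_ : 1 = 1%:~R) // (_ : -1 = (-1)%:~R) // !ltr_int => m0.
have {}m0 : m = 0 by lia.
by apply/eqP; rewrite -subr_eq0 e m0.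
Qed.

Section Signed.
Variables a1 a2 : rat.
Let A (i : bool) := if i then a2 else a1.

(** Modulo Z, multiplication by [u] preserves the pair up to the common sign [eps];
    it exchanges the two members when [s] is true. *)
Definition signed_stable (u : nat) := exists eps : rat, (eps == 1) || (eps == -1) /\
  exists s : bool, forall i, eqZ (u%:R * A i) (eps * A (s (+) i)).

Lemma signed_stable_int (eps : rat) : (eps == 1) || (eps == -1) -> eps \is a Num.int.
Proof. by case/orP => /eqP->; rewrite ?rpredN rpred1. Qed.

Lemma signed_stableM u v : signed_stable u -> signed_stable v -> signed_stable (u * v).
Proof.
move=> [e [he [s hu]]] [f [hf [t hv]]].
exists (f * e); split.
  by case/orP: he => /eqP->; case/orP: hf => /eqP->; rewrite ?mulr1 ?mul1r ?mulrN1 ?opprK eqxx ?orbT.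
exists (s (+) t) => i.
have h1 := eqZ_mul (natr_int rat u) (hv i).
have h2 := eqZ_mul (signed_stable_int hf) (hu (t (+) i)).
apply: eqZ_trans (_ : eqZ _ (u%:R * (f * A (t (+) i)))) _; first by rewrite natrM -mulrA.
by rewrite mulrCA -mulrA -addbA.
Qed.

Lemma signed_stable1 : signed_stable 1.
Proof. by exists 1; rewrite eqxx; split=> //; exists false => i; exact: eqZ_refl. Qed.

Lemma signed_stable_big B n : (forall p, prime p -> (B < p)%N -> signed_stable p) ->
  (0 < n)%N -> (forall p, prime p -> (p %| n)%N -> (B < p)%N) -> signed_stable n.
Proof.
move=> HB; elim/ltn_ind: n => n IH n0 nB.
have [n1|n1] := leqP n 1; first by have -> : n = 1%N by [lia]; exact: signed_stable1.
have pr := pdiv_prime n1; have pd := pdiv_dvd n.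
rewrite -(divnK pd) mulnC; apply: signed_stableM; first by apply: HB => //; exact: nB.
apply: IH.
- by apply: ltn_Pdiv => //; exact: prime_gt1.
- by rewrite divn_gt0 ?pdiv_gt0 // dvdn_leq.
by move=> q pr_q qn; apply: nB => //; apply: dvdn_trans qn (dvdn_div pd).
Qed.

Lemma signed_stable_mod d u v : a1 * d%:R \is a Num.int -> a2 * d%:R \is a Num.int ->
  u = v %[mod d] -> signed_stable u -> signed_stable v.
Proof.
move=> d1 d2 uv [e [he [s hu]]]; exists e; split=> //; exists s => i.
apply: eqZ_trans (hu i); rewrite /eqZ -mulrBl (divn_eq u d) (divn_eq v d) uv.
rewrite !natrD !natrM.
have -> : ((v %/ d)%:R * d%:R + (v %% d)%:R - ((u %/ d)%:R * d%:R + (v %% d)%:R)) * A i =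
  ((v %/ d)%:R - (u %/ d)%:R) * (A i * d%:R) by ring.
by rewrite rpredM ?rpredB ?natr_int //; case: (i).
Qed.

(** The Chinese remainder theorem gives an integer congruent to u modulo d all of
    whose prime factors are greater than B: take it congruent to 1 modulo the part
    of B! prime to d. *)
Lemma signed_stable_coprime d u B : (0 < d)%N ->
  a1 * d%:R \is a Num.int -> a2 * d%:R \is a Num.int -> coprime d u ->
  (forall p, prime p -> (B < p)%N -> signed_stable p) -> signed_stable u.
Proof.
move=> d0 d1 d2 cdu HB.
pose M := (partn B`! \pi(d)^')%N.
have cdM : coprime d M by apply: (@pnat_coprime \pi(d)); [exact: pnat_pi | exact: part_pnat].
pose n := chinese d M u 1.
have nu : n = u %[mod d] by exact: chinese_modl.
have nM : n = 1 %[mod M] by exact: chinese_modr.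
have [n0|n_gt0] := posnP n.
  have d1' : (d %| u)%N by rewrite /dvdn -nu n0 mod0n.
  have dE : d = 1%N by rewrite -(eqP cdu); apply/esym/gcdn_idPl.
  have := signed_stable1; apply: (signed_stable_mod d1 d2); by rewrite dE !modn1.
apply: (signed_stable_mod d1 d2 nu); apply: (signed_stable_big HB n_gt0) => q pr_q qn.
rewrite ltnNge; apply/negP => qB.
have [qd|qd] := boolP (q %| d)%N.
  have : (q %| u)%N by rewrite /dvdn -(modn_dvdm u qd) -nu (modn_dvdm n qd) -/(dvdn q n).
  move=> qu; have : (q %| gcdn d u)%N by rewrite dvdn_gcd qd.
  by rewrite (eqP cdu) dvdn1 => /eqP q1; rewrite q1 in pr_q.
have qM : (q %| M)%N.
  rewrite -(@Gauss_dvdr _ (partn B`! \pi(d))).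
    by rewrite partnC ?fact_gt0 // dvdn_fact // prime_gt0.
  rewrite prime_coprime //; apply: contra qd => qp.
  have := part_pnat \pi(d) B`!; move/pnatP => /(_ (part_gt0 _ _)) /(_ q pr_q qp).
  by rewrite mem_primes => /and3P[].
have : (q %| 1)%N by rewrite /dvdn -(modn_dvdm 1 qM) -nM (modn_dvdm n qM) -/(dvdn q n).
by rewrite dvdn1 => /eqP q1; rewrite q1 in pr_q.
Qed.

Lemma signed_stable_sqr u i : signed_stable u -> eqZ ((u * u)%N%:R * A i) (A i).
Proof.
move=> [e [he [s hu]]]; have h1 := eqZ_mul (natr_int rat u) (hu i).
have h2 := eqZ_mul (signed_stable_int he) (hu (s (+) i)).
rewrite natrM -mulrA; apply: eqZ_trans h1 _; rewrite mulrCA; apply: eqZ_trans h2 _.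
rewrite addbA addbb mulrA -expr2 (_ : e ^+ 2 = 1) ?mul1r; first exact: eqZ_refl.
by case/orP: he => /eqP->; rewrite ?sqrrN expr1n.
Qed.

End Signed.

(** If 5 does not divide d take u = 5, and 24 = 25 - 1.  Otherwise some u prime to
    d is 2 modulo 5, and its square 4 is not 1. *)
Lemma dvdn24_sqr d : (0 < d)%N ->
  (forall u, coprime d u -> u * u = 1 %[mod d])%N -> (d %| 24)%N.
Proof.
move=> d0 H; have [c5|c5] := boolP (coprime d 5).
  by have := H 5%N c5 => /eqP; rewrite eqn_mod_dvd.
have d5 : (5 %| d)%N by rewrite coprime_sym prime_coprime // negbK in c5.
have [m cm dE] := p_part (isT : prime 5) d0.
set k := logn 5 d in dE.
pose u := chinese 5 m 2 1.
have u5 : u = 2 %[mod 5] by exact: chinese_modl.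
have um : u = 1 %[mod m] by exact: chinese_modr.
have cu : coprime d u.
  rewrite dE coprimeMl -(coprime_modr _ u) um coprime_modr coprimen1 /=.
  by rewrite coprimeXl // -coprime_modr u5.
have := H u cu => /(congr1 (modn^~ 5)); rewrite !(modn_dvdm _ d5).
by rewrite -modnMml u5 modnMml -modnMmr u5 modnMmr.
Qed.

(** * The 28 pairs, and the first coefficients of G / F *)

(** The numerators of the pairs over the denominator 24, see [mirror24E]. *)
Definition mirror24 : seq (nat * nat) :=
  [:: (12, 12); (16, 8); (18, 6); (20, 4);
      (4, 4); (8, 4); (12, 4); (8, 8); (16, 16);
      (6, 6); (12, 6); (18, 12); (18, 18);
      (12, 8); (16, 4); (16, 12); (20, 8); (20, 12);
      (20, 16); (20, 20); (9, 3); (15, 3);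
      (21, 9); (21, 15); (10, 2); (14, 2);
      (22, 10); (22, 14)].

Lemma mirror24E : mirror_pairs = [seq (ij.1%:R / 24%:R, ij.2%:R / 24%:R) | ij <- mirror24].
Proof. by rewrite /mirror_pairs /mirror24 /=; do !congr (_ :: _); congr (_, _); field. Qed.

(** The condition [signed_stable] for i / 24 and j / 24, see [signed_stable24P]. *)
Definition signed_stable24 (u i j : nat) : bool :=
  [|| (u * i == i %[mod 24]) && (u * j == j %[mod 24]),
      (24 %| u * i + i) && (24 %| u * j + j),
      (u * i == j %[mod 24]) && (u * j == i %[mod 24]) |
      (24 %| u * i + j) && (24 %| u * j + i)]%N.

Definition units24 : seq nat := [:: 1; 5; 7; 11; 13; 17; 19; 23]%N.

Lemma signed_stable24_mirror : all (fun i => all (fun j =>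
   all (fun u => signed_stable24 u i j) units24 ==
     (((i, j) \in mirror24) || ((j, i) \in mirror24))) (iota 1 23)) (iota 1 23).
Proof. by vm_compute. Qed.

Lemma eqZ24 (x y : int) : eqZ (x%:~R / 24%:R) (y%:~R / 24%:R) <-> (24 %| x - y)%Z.
Proof.
split=> [/intrP[m e]|/dvdzP[m e]]; last first.
  by apply/intrP; exists m; rewrite -mulrBl -intrB e intrM mulfK.
apply/dvdzP; exists m; apply/eqP; rewrite -(eqr_int rat) intrM -e intrB -mulrBl.
by rewrite mulfVK.
Qed.

Lemma signed_stable24P u i j :
  signed_stable (i%:R / 24%:R) (j%:R / 24%:R) u <-> signed_stable24 u i j.
Proof.
have E (k : nat) : k%:R / 24%:R = k%:Z%:~R / 24%:R :> rat by [].
have P (k l : nat) : eqZ (u%:R * (k%:R / 24%:R)) (1 * (l%:R / 24%:R)) <-> (u * k == l %[mod 24])%N.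
  have -> : u%:R * (k%:R / 24%:R) = (u * k)%N%:Z%:~R / 24%:R :> rat by rewrite -pmulrn natrM mulrA.
  have -> : 1 * (l%:R / 24%:R) = l%:Z%:~R / 24%:R :> rat by rewrite mul1r.
  by rewrite eqZ24 -eqz_mod_dvd -eqz_nat -!modz_nat.
have M (k l : nat) : eqZ (u%:R * (k%:R / 24%:R)) (-1 * (l%:R / 24%:R)) <-> (24 %| u * k + l)%N.
  have -> : u%:R * (k%:R / 24%:R) = (u * k)%N%:Z%:~R / 24%:R :> rat by rewrite -pmulrn natrM mulrA.
  have -> : -1 * (l%:R / 24%:R) = (- l%:Z)%:~R / 24%:R :> rat by rewrite mulN1r intrN mulNr.
  by rewrite eqZ24 opprK -PoszD.
split=> [[e [he [s hs]]] | ].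
  have := hs false; have := hs true; rewrite /signed_stable24.
  case/orP: he => /eqP->; case: s {hs} => /=.
  - by move=> /P h1 /P h2; rewrite h1 h2 !orbT.
  - by move=> /P h1 /P h2; rewrite h1 h2.
  - by move=> /M h1 /M h2; rewrite h1 h2 !orbT.
  - by move=> /M h1 /M h2; rewrite h1 h2 !orbT.
case/or4P => /andP[h1 h2].
- by exists 1; rewrite eqxx; split=> //; exists false => -[] /=; apply/P.
- by exists (-1); rewrite eqxx orbT; split=> //; exists false => -[] /=; apply/M.
- by exists 1; rewrite eqxx; split=> //; exists true => -[] /=; apply/P.
- by exists (-1); rewrite eqxx orbT; split=> //; exists true => -[] /=; apply/M.
Qed.

(** The unordered pair b1, b2 is the pair a1, a2 or the pair 1 - a1, 1 - a2. *)
Definition pm_pair (a1 a2 b1 b2 : rat) :=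
  [|| (b1 == a1) && (b2 == a2), (b1 == a2) && (b2 == a1),
      (b1 == 1 - a1) && (b2 == 1 - a2) | (b1 == 1 - a2) && (b2 == 1 - a1)].

Lemma Gratio_sym a1 a2 : Gratio a1 a2 = Gratio a2 a1.
Proof.
have F_sym : Fseries a1 a2 = Fseries a2 a1 by apply: fpsP => n; rewrite !FseriesE mulrC.
rewrite /Gratio F_sym; congr fps_div; apply: fpsP => n.
by rewrite !GseriesE F_sym /log_coef addrC.
Qed.

Lemma Gratio_pm a1 a2 b1 b2 : 0 < a1 < 1 -> 0 < a2 < 1 -> pm_pair a1 a2 b1 b2 ->
  Gratio b1 b2 = Gratio a1 a2.
Proof.
move=> h1 h2; case/or4P => /andP[/eqP-> /eqP->] //.
- exact: Gratio_sym.
- exact: Gratio_compl.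
- by rewrite Gratio_sym; exact: Gratio_compl.
Qed.

(** The coefficient of z in w, and four times the coefficient of z^2. *)
Definition coef_c (a1 a2 : rat) := a1 + a2 - 2 * (a1 * a2).
Definition coef_4w2 (a1 a2 : rat) :=
  let c := coef_c a1 a2 in let e := a1 * a2 in c ^+ 2 + c + (1 - c) * e - e ^+ 2.

Lemma Gratio_coef1 a1 a2 : 0 < a1 -> 0 < a2 -> Gratio a1 a2 1%N = coef_c a1 a2.
Proof.
move=> a1_gt0 a2_gt0; have := Gseries_S a1_gt0 a2_gt0 0.
have := congr1 (fun f : fps => f 1%N) (GratioE a1 a2).
have := Fseries_S a1 a2 0.
rewrite fps_coefM !big_ord_recl big_ord0 /= Fseries0 Gratio0 Gseries0 /bump /=.
rewrite /coef_c => hF <-; move: hF; rewrite subn0 => hF.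
by move: (Fseries a1 a2 1) (Gratio a1 a2 1) hF => F w hF h; lra.
Qed.

Lemma Gratio_coef2 a1 a2 : 0 < a1 -> 0 < a2 -> 4 * Gratio a1 a2 2%N = coef_4w2 a1 a2.
Proof.
move=> a1_gt0 a2_gt0; have w1 := Gratio_coef1 a1_gt0 a2_gt0.
have G1 := Gseries_S a1_gt0 a2_gt0 0; have G2 := Gseries_S a1_gt0 a2_gt0 1.
have F1 := Fseries_S a1 a2 0; have F2 := Fseries_S a1 a2 1.
have := congr1 (fun f : fps => f 2%N) (GratioE a1 a2).
have := congr1 (fun f : fps => f 1%N) (GratioE a1 a2).
rewrite !fps_coefM !big_ord_recl !big_ord0 /= /bump /= !subn0 !subSS !subn0 Fseries0 Gratio0 w1.
rewrite Fseries0 Gseries0 in F1 F2 G1 G2.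
move: (Fseries a1 a2 1) (Fseries a1 a2 2) (Gseries a1 a2 1) (Gseries a1 a2 2) (Gratio a1 a2 2) F1 F2 G1 G2.
rewrite /coef_4w2 /coef_c => f1 f2 g1 g2 w2 F1 F2 G1 G2 h1 h2.
have e1 : f1 = a1 * a2 by lra.
have e2 : g1 = a1 + a2 - 2 * (a1 * a2) by lra.
rewrite e1 e2 in F2 G2 h1 h2.
nra.
Qed.

(** For a given c the second coefficient is a quadratic polynomial in e = a1 a2; its
    roots are e and 1 - c - e = (1 - a1) (1 - a2). *)
Lemma coef_determines a1 a2 b1 b2 : coef_c b1 b2 = coef_c a1 a2 ->
  coef_4w2 b1 b2 = coef_4w2 a1 a2 -> pm_pair a1 a2 b1 b2.
Proof.
move=> hc; rewrite /coef_4w2 hc => hw.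
have : (b1 * b2 - a1 * a2) * (1 - coef_c a1 a2 - b1 * b2 - a1 * a2) = 0 by nra.
have pairP x y : b1 + b2 = x + y -> b1 * b2 = x * y -> (b1 == x) && (b2 == y) || (b1 == y) && (b2 == x).
  move=> hs he; have : (b1 - x) * (b1 - y) = 0 by nra.
  by move/eqP; rewrite mulf_eq0 !subr_eq0 => /orP[] /eqP bE; rewrite bE eqxx; apply/orP; [left | right];
    apply/eqP; lra.
move: hc; rewrite /coef_c => hc /eqP; rewrite mulf_eq0 => /orP[] /eqP h; rewrite /pm_pair.
  have hs : b1 + b2 = a1 + a2 by lra.
  have he : b1 * b2 = a1 * a2 by lra.
  by case/orP: (pairP _ _ hs he) => ->; rewrite ?orbT.
have hs : b1 + b2 = 1 - a1 + (1 - a2) by lra.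
have he : b1 * b2 = (1 - a1) * (1 - a2) by lra.
by case/orP: (pairP _ _ hs he) => ->; rewrite ?orbT.
Qed.

(** * The two implications *)

Section Prime.
Variable p : nat.
Hypothesis pr_p : prime p.

Let p_gt0 : (0 < p)%N := prime_gt0 pr_p.
Let p0 : p%:R != 0 :> rat.
Proof. by rewrite pnatr_eq0 -lt0n. Qed.

Lemma int_divp x : x \is a Num.int -> x / p%:R \in Zloc p -> x / p%:R \is a Num.int.
Proof.
move=> xZ xp; apply: int_Zloc => q pr_q; have [->//|qp] := eqVneq q p.
apply: rpredM; first exact: Zloc_int.
by apply: Zloc_invn; rewrite prime_coprime // dvdn_prime2.
Qed.

(** An integer multiple of p smaller than p is zero. *)
Lemma int_divp_small x : x \is a Num.int -> x / p%:R \in Zloc p -> `|x| < p%:R -> x = 0.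
Proof.
move=> xZ xp xs; have /intrP[m e] := int_divp xZ xp.
have xE : x = m%:~R * p%:R by rewrite -e divfK.
move: xs; rewrite xE normrM [`|p%:R|]ger0_norm ?ler0n // gtr_pMl ?ltr0n //.
rewrite -intr_norm (_ : 1 = 1%:~R) // ltr_int => m0.
by have -> : m = 0 by [lia]; rewrite mul0r.
Qed.

Variables (a a' : rat) (t : nat).
Hypothesis aa' : dwork_prime p a a' t.

Lemma dwork_prime_den d : a * d%:R \is a Num.int -> a' * d%:R \is a Num.int.
Proof.
have [tp aZ a'Z a0 e] := aa' => ad.
have -> : a' * d%:R = (a * d%:R + t%:R * d%:R) / p%:R.
  by rewrite -mulrDl -e mulrAC mulfK.
apply: int_divp.
  by apply: rpredD => //; apply: rpredM; exact: natr_int.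
rewrite -mulrDl -e mulrAC mulfK //.
by rewrite rpredM ?rpred_nat.
Qed.

Lemma dwork_prime_lt1 : a < 1 -> a' < 1.
Proof.
have [tp aZ a'Z a0 e] := aa' => a1; rewrite -(ltr_pM2r (x := p%:R)) ?ltr0n // e mul1r.
have : t.+1%:R <= p%:R :> rat by rewrite ler_nat.
by rewrite -natr1; lra.
Qed.

Lemma dwork_prime_eqZ : eqZ (p%:R * a') a.
Proof. by have [_ _ _ _ e] := aa'; rewrite /eqZ mulrC e addrAC subrr add0r natr_int. Qed.

End Prime.

Lemma coef_bounds a1 a2 : 0 < a1 < 1 -> 0 < a2 < 1 ->
  0 <= coef_c a1 a2 <= 1 /\ -1 <= coef_4w2 a1 a2 <= 3.
Proof.
move=> /andP[a10 a11] /andP[a20 a21].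
have c01 : 0 <= coef_c a1 a2 <= 1 by rewrite /coef_c; apply/andP; split; nra.
have e01 : 0 <= a1 * a2 <= 1 by apply/andP; split; nra.
split=> //; rewrite /coef_4w2; move: (coef_c a1 a2) (a1 * a2) c01 e01 => c e.
by move=> /andP[c0 c1] /andP[e0 e1]; apply/andP; split; nra.
Qed.

Lemma coef_den a1 a2 d : a1 * d%:R \is a Num.int -> a2 * d%:R \is a Num.int ->
  coef_c a1 a2 * d%:R ^+ 4 \is a Num.int /\ coef_4w2 a1 a2 * d%:R ^+ 4 \is a Num.int.
Proof.
move=> h1 h2; have hd := natr_int rat d.
have eZ : (a1 * a2) * d%:R ^+ 2 \is a Num.int.
  by rewrite (_ : _ * _ = a1 * d%:R * (a2 * d%:R)); [exact: rpredM | ring].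
have cZ : coef_c a1 a2 * d%:R ^+ 2 \is a Num.int.
  rewrite (_ : _ * _ = a1 * d%:R * d%:R + a2 * d%:R * d%:R - 2 * (a1 * a2 * d%:R ^+ 2)); last first.
    by rewrite /coef_c; ring.
  by apply: rpredB; [apply: rpredD; apply: rpredM | apply: rpredM].
have dZ : d%:R ^+ 2 \is a @Num.int rat by rewrite rpredX.
rewrite /coef_4w2; move: (coef_c a1 a2) (a1 * a2) cZ eZ => c e cZ eZ.
split; first by rewrite (_ : _ * _ = c * d%:R ^+ 2 * d%:R ^+ 2); [exact: rpredM | ring].
rewrite (_ : _ * _ = (c * d%:R ^+ 2) * (c * d%:R ^+ 2) + c * d%:R ^+ 2 * d%:R ^+ 2 +
  (d%:R ^+ 2 - c * d%:R ^+ 2) * (e * d%:R ^+ 2) - (e * d%:R ^+ 2) * (e * d%:R ^+ 2)); last by ring.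
apply: rpredB; last exact: rpredM.
apply: rpredD; last by apply: rpredM => //; exact: rpredB.
by apply: rpredD; exact: rpredM.
Qed.

Lemma rat_den (a : rat) : a * `|denq a|%N%:R \is a Num.int.
Proof.
have -> : (`|denq a|%N)%:R = (denq a)%:~R :> rat.
  by rewrite -[in RHS](gez0_abs (ltW (denq_gt0 a))).
by rewrite -numqE intr_int.
Qed.

Section Main.
Variables a1 a2 : rat.
Hypotheses (ha1 : 0 < a1 < 1) (ha2 : 0 < a2 < 1).

Let a1_gt0 : 0 < a1. Proof. by case/andP: ha1. Qed.
Let a2_gt0 : 0 < a2. Proof. by case/andP: ha2. Qed.

Let d := lcmn `|denq a1| `|denq a2|.
Let d_gt0 : (0 < d)%N. Proof. by rewrite lcmn_gt0 !absz_gt0 !denq_eq0. Qed.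

Let ad1 : a1 * d%:R \is a Num.int.
Proof.
have /dvdnP[k dk] : (`|denq a1| %| d)%N by exact: dvdn_lcml.
by rewrite dk natrM mulrCA rpredM ?natr_int ?rat_den.
Qed.

Let ad2 : a2 * d%:R \is a Num.int.
Proof.
have /dvdnP[k dk] : (`|denq a2| %| d)%N by exact: dvdn_lcmr.
by rewrite dk natrM mulrCA rpredM ?natr_int ?rat_den.
Qed.

Let Zloc_den p : coprime p d -> a1 \in Zloc p /\ a2 \in Zloc p.
Proof. by move=> cp; split; apply/ZlocP; exists d. Qed.

(** The differences of the first two coefficients of w for a' and for a are
    divisible by p, while the common denominator d bounds them independently of p. *)
Lemma integral_large_prime : N_integral (mirror_map a1 a2) ->
  exists B, forall p, prime p -> (B < p)%N -> signed_stable a1 a2 p.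
Proof.
(* d ^ 4 clears the denominators of both differences, which are at most 4 *)
move=> [N [N_gt0 Nint]]; exists (N + d + 5 * d ^ 4)%N => p pr_p pB.
have cpN : coprime p N by rewrite prime_coprime // gtnNdvd //; lia.
have cpd : coprime p d by rewrite prime_coprime // gtnNdvd //; lia.
have [a1Z a2Z] := Zloc_den cpd.
have EZ : fint p (fps_exp (Gratio a1 a2)).
  move=> n; have := Nint n.+1; rewrite /fps_scale /mirror_map /fps_mulz -/(Gratio a1 a2) => En.
  have N0 : N%:R != 0 :> rat by rewrite pnatr_eq0 -lt0n.
  apply: eq_mem_Zloc (rpredM (Zloc_int p En) (_ : N%:R^-1 ^+ n.+1 \in Zloc p)) _.
    by rewrite rpredX // Zloc_invn.
  by rewrite exprVn mulfK // expf_neq0.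
have [b1 [t1 d1]] := dwork_prime_exists pr_p a1Z a1_gt0.
have [b2 [t2 d2]] := dwork_prime_exists pr_p a2Z a2_gt0.
have b1_gt0 := dwork_prime_gt0 pr_p d1; have b2_gt0 := dwork_prime_gt0 pr_p d2.
have hb1 : 0 < b1 < 1 by rewrite b1_gt0 (dwork_prime_lt1 pr_p d1) //; case/andP: ha1.
have hb2 : 0 < b2 < 1 by rewrite b2_gt0 (dwork_prime_lt1 pr_p d2) //; case/andP: ha2.
have coefE k : cong p p%:R (Gratio b1 b2 k) (Gratio a1 a2 k).
  have h1 := dieudonne_dwork_conv pr_p (Gratio0 a1 a2) EZ (0 + p * k)%N.
  have h2 := dwork_congruence pr_p d1 d2 (0 + p * k)%N.
  have := cong_trans h2 (cong_sym h1).
  by rewrite !fps_coef_subst ?prime_gt0.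
have d4 : 0 < d%:R ^+ 4 :> rat by rewrite exprn_gt0 // ltr0n.
have d4p : 5 * d%:R ^+ 4 < p%:R :> rat.
  by rewrite -natrX -natrM ltr_nat; lia.
have [cZ wZ] := coef_den ad1 ad2.
have [cZ' wZ'] := coef_den (dwork_prime_den pr_p d1 ad1) (dwork_prime_den pr_p d2 ad2).
have [/andP[c0 c1] /andP[w0 w1]] := coef_bounds ha1 ha2.
have [/andP[c0' c1'] /andP[w0' w1']] := coef_bounds hb1 hb2.
have vanish x y : x * d%:R ^+ 4 \is a Num.int -> y * d%:R ^+ 4 \is a Num.int ->
    cong p p%:R y x -> -4 <= y - x <= 4 -> y = x.
  move=> xZ yZ yx /andP[lo hi]; apply/eqP; rewrite -subr_eq0.
  suff /eqP : (y - x) * d%:R ^+ 4 = 0 by rewrite mulf_eq0 (gt_eqF d4) orbF.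
  apply: (int_divp_small pr_p); first by rewrite mulrBl rpredB.
    by rewrite mulrAC rpredM ?rpredX ?rpred_nat.
  rewrite normrM (gtr0_norm d4); apply: le_lt_trans d4p.
  have : `|y - x| <= 4 by rewrite ler_norml lo.
  by move=> h; rewrite ler_pM2r //; lra.
have eqc : coef_c b1 b2 = coef_c a1 a2.
  apply: vanish => //; last by apply/andP; split; lra.
  by rewrite -!Gratio_coef1.
have eqw : coef_4w2 b1 b2 = coef_4w2 a1 a2.
  apply: vanish => //; last by apply/andP; split; lra.
  by rewrite -!Gratio_coef2 // /cong -mulrBr -mulrA rpredM ?rpred_nat //; exact: coefE.
have e1 := dwork_prime_eqZ d1; have e2 := dwork_prime_eqZ d2.
have neg x y : eqZ (p%:R * (1 - x)) y -> eqZ (p%:R * x) (-1 * y).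
  move=> h; apply: eqZ_trans (eqZ_mul (rpredN1 _) h); rewrite /eqZ.
  rewrite (_ : _ - _ = p%:R) ?natr_int //; ring.
case/or4P: (coef_determines eqc eqw) => /andP[/eqP b1E /eqP b2E]; rewrite b1E in e1; rewrite b2E in e2.
- by exists 1; rewrite eqxx; split=> //; exists false => -[] /=; rewrite mul1r.
- by exists 1; rewrite eqxx; split=> //; exists true => -[] /=; rewrite mul1r.
- by exists (-1); rewrite eqxx orbT; split=> //; exists false => -[] /=; apply: neg.
- by exists (-1); rewrite eqxx orbT; split=> //; exists true => -[] /=; apply: neg.
Qed.

(** The denominator of the pair divides 24, and the units modulo 24 act on it by
    signs and exchanges. *)
Lemma integral_imp_mirror24 : N_integral (mirror_map a1 a2) ->
  exists i j : nat, [/\ (0 < i < 24)%N, (0 < j < 24)%N, a1 = i%:R / 24%:R, a2 = j%:R / 24%:R &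
    all (fun u => signed_stable24 u i j) units24].
Proof.
move=> /integral_large_prime[B HB].
have su u : coprime d u -> signed_stable a1 a2 u.
  by move=> cdu; exact: (signed_stable_coprime d_gt0 ad1 ad2 cdu HB).
have d24 : (d %| 24)%N.
  apply: dvdn24_sqr => // u cdu; have [|u_gt0] := posnP u.
    move=> u0; move: cdu; rewrite u0 /coprime gcdn0 => /eqP ->; by rewrite !modn1.
  have sq := signed_stable_sqr _ (su u cdu).
  have den (a : rat) : eqZ ((u * u)%N%:R * a) a -> (`|denq a| %| u * u - 1)%N.
    rewrite /eqZ -{2}[a]mul1r -mulrBl -(natrB _ (_ : 1 <= u * u)%N) ?muln_gt0 ?u_gt0 //.
    move=> /intrP[m e].
    have /eqP : ((u * u - 1)%N%:Z * numq a)%:~R = (m * denq a)%:~R :> rat.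
      by rewrite !intrM -e numqE -pmulrn; ring.
    rewrite eqr_int => /eqP /(congr1 absz); rewrite !abszM /= => {}e.
    by rewrite -(@Gauss_dvdl _ _ `|numq a|%N) ?e ?dvdn_mull // coprime_sym coprime_num_den.
  have : (d %| u * u - 1)%N.
    by rewrite dvdn_lcm (den _ (sq false)) (den _ (sq true)).
  by move=> h; apply/eqP; rewrite eqn_mod_dvd // muln_gt0 u_gt0.
have num (a : rat) : 0 < a < 1 -> a * d%:R \is a Num.int ->
    exists2 i : nat, (0 < i < 24)%N & a = i%:R / 24%:R.
  move=> /andP[a0 a1'] aZ.
  have : a * 24%:R \is a Num.int.
    by case/dvdnP: d24 => k ->; rewrite natrM mulrCA rpredM ?natr_int.
  case/intrP=> m e.
  have m0 : 0 < m by have h : (0 < m%:~R :> rat) by [lra]; rewrite ltr0z in h.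
  have m24 : m < 24%:Z.
    by have h : (m%:~R < 24%:Z%:~R :> rat) by [lra]; rewrite ltr_int in h.
  exists `|m|%N; first by lia.
  have -> : `|m|%N%:R = m%:~R :> rat by rewrite -[in RHS](gtz0_abs m0).
  by rewrite -e mulfK.
have [i i24 iE] := num _ ha1 ad1; have [j j24 jE] := num _ ha2 ad2.
exists i, j; split=> //; apply/allP => u uu; apply/signed_stable24P; rewrite -iE -jE; apply: su.
by apply: coprime_dvdl d24 _; move: uu; rewrite !inE; do ?[case/orP]; move/eqP->.
Qed.

(** As p^2 = 1 modulo 24, the Dwork primes are p a1 and p a2 modulo Z, that is the
    pair itself or its complement. *)
Lemma mirror24_integral i j : (0 < i < 24)%N -> (0 < j < 24)%N ->
  a1 = i%:R / 24%:R -> a2 = j%:R / 24%:R -> all (fun u => signed_stable24 u i j) units24 ->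
  N_integral (mirror_map a1 a2).
Proof.
move=> i24 j24 iE jE st.
have [N N_gt0 Nsmall] := exp_Gratio_scale_upto 24 a1_gt0 a2_gt0.
exists N; split=> //.
have a24 : a1 * 24%:R \is a Num.int /\ a2 * 24%:R \is a Num.int.
  by rewrite iE jE !divfK // !natr_int.
suff EZ p : prime p -> fint p (fps_scale N%:R (fps_exp (Gratio a1 a2))).
  case=> [|n]; first by rewrite /fps_scale /mirror_map /= mul0r rpred0.
  apply: int_Zloc => p pr_p; have := EZ p pr_p n; rewrite /fps_scale /mirror_map /= => h.
  by rewrite exprSr mulrA rpredM ?rpred_nat.
move=> pr_p; have [p24|p24] := ltnP p 24; first exact: Nsmall.
apply: fint_scale.
have cp : coprime p 24 by rewrite prime_coprime // gtnNdvd // ltn_neqAle p24 andbT; case: eqP pr_p => // <-.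
have [a1Z a2Z] : a1 \in Zloc p /\ a2 \in Zloc p.
  by case: a24 => h1 h2; split; apply/ZlocP; exists 24%N.
have [b1 [t1 d1]] := dwork_prime_exists pr_p a1Z a1_gt0.
have [b2 [t2 d2]] := dwork_prime_exists pr_p a2Z a2_gt0.
have b1_gt0 := dwork_prime_gt0 pr_p d1; have b2_gt0 := dwork_prime_gt0 pr_p d2.
have hb1 : 0 < b1 < 1 by rewrite b1_gt0 (dwork_prime_lt1 pr_p d1) //; case/andP: ha1.
have hb2 : 0 < b2 < 1 by rewrite b2_gt0 (dwork_prime_lt1 pr_p d2) //; case/andP: ha2.
have r24 : (p %% 24)%N \in units24.
  have : coprime (p %% 24) 24 by rewrite coprime_modl.
  by move: (p %% 24)%N (ltn_pmod p (isT : 0 < 24)%N); do 24?[case=> //].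
have [eps [he [s hs]]] : signed_stable a1 a2 p.
  case: a24 => h1 h2; apply: (signed_stable_mod h1 h2 (modn_mod p 24)); rewrite iE jE.
  by apply/signed_stable24P; exact: (allP st).
have pp1 : p * p = 1 %[mod 24].
  by rewrite -modnMml -modnMmr; move: r24; rewrite !inE; do ?[case/orP]; move/eqP->.
have inv b a t : dwork_prime p a b t -> a * 24%:R \is a Num.int -> eqZ b (p%:R * a).
  move=> da a24'; have b24 := dwork_prime_den pr_p da a24'.
  apply: eqZ_trans (eqZ_mul (natr_int _ p) (dwork_prime_eqZ da)).
  have /dvdnP[k kE] : (24 %| p * p - 1)%N by rewrite -eqn_mod_dvd ?pp1 // muln_gt0 prime_gt0.
  have ppE : p%:R * p%:R = (k * 24)%N%:R + 1 :> rat.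
    by rewrite -kE -natrM natrB ?muln_gt0 ?prime_gt0 // subrK.
  rewrite /eqZ mulrA ppE natrM.
  have -> : b - (k%:R * 24%:R + 1) * b = - (k%:R * (b * 24%:R)) by ring.
  by rewrite rpredN; apply: rpredM => //; exact: natr_int.
have e1 : eqZ b1 (eps * (if s then a2 else a1)).
  case: a24 => h _; apply: eqZ_trans (inv _ _ _ d1 h) _.
  by have := hs false; case: (s).
have e2 : eqZ b2 (eps * (if s then a1 else a2)).
  case: a24 => _ h; apply: eqZ_trans (inv _ _ _ d2 h) _.
  by have := hs true; case: (s).
have pmE : pm_pair a1 a2 b1 b2.
  have plus x y : 0 < x < 1 -> 0 < y < 1 -> eqZ x (1 * y) -> x == y.
    by move=> hx hy; rewrite mul1r => h; apply/eqP; exact: eqZ_unit_interval.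
  have minus x y : 0 < x < 1 -> 0 < y < 1 -> eqZ x (-1 * y) -> x == 1 - y.
    move=> hx /andP[y0 y1] h; apply/eqP; apply: eqZ_unit_interval => //.
      by apply/andP; split; lra.
    by apply: eqZ_trans h _; rewrite /eqZ (_ : _ - _ = -1) ?rpredN1 //; ring.
  rewrite /pm_pair; case/orP: he e1 e2 => /eqP->; case: (s) => h1 h2.
  - by rewrite (plus _ _ hb1 ha2 h1) (plus _ _ hb2 ha1 h2) orbT.
  - by rewrite (plus _ _ hb1 ha1 h1) (plus _ _ hb2 ha2 h2).
  - by rewrite (minus _ _ hb1 ha2 h1) (minus _ _ hb2 ha1 h2) !orbT.
  - by rewrite (minus _ _ hb1 ha1 h1) (minus _ _ hb2 ha2 h2) !orbT.
apply: (dieudonne_dwork pr_p (Gratio0 a1 a2)) => n.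
by have := dwork_congruence pr_p d1 d2 n; rewrite (Gratio_pm ha1 ha2 pmE).
Qed.

End Main.

Theorem mainTheorem2 (a1 a2 : rat)
    (ha1 : 0 < a1 < 1) (ha2 : 0 < a2 < 1) :
  N_integral (mirror_map a1 a2) <->
  ((a1, a2) \in mirror_pairs) || ((a2, a1) \in mirror_pairs).
Proof.
have tab i j : (0 < i < 24)%N -> (0 < j < 24)%N ->
    all (fun u => signed_stable24 u i j) units24 = ((i, j) \in mirror24) || ((j, i) \in mirror24).
  move=> hi hj; have /allP/(_ i)/[!mem_iota] := signed_stable24_mirror.
  by move=> /(_ hi)/allP/(_ j)/[!mem_iota]/(_ hj)/eqP.
split=> [/(integral_imp_mirror24 ha1 ha2)[i [j [hi hj -> ->]]] | ].
  rewrite (tab _ _ hi hj) mirror24E.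
  by case/orP => /(map_f (fun ij => (ij.1%:R / 24%:R, ij.2%:R / 24%:R) : rat * rat)) /= ->; rewrite ?orbT.
have bound i j : (i, j) \in mirror24 -> (0 < i < 24)%N /\ (0 < j < 24)%N.
  move=> ij; have /allP/(_ _ ij) : all (fun ij => (0 < ij.1 < 24) && (0 < ij.2 < 24))%N mirror24 by [].
  by case/andP.
rewrite mirror24E => /orP[] /mapP[[i j] ij [e1 e2]]; have [hi hj] := bound _ _ ij.
  by apply: (mirror24_integral ha1 ha2 hi hj e1 e2); rewrite tab // ij.
by apply: (mirror24_integral ha1 ha2 hj hi e2 e1); rewrite tab // ij orbT.
Qed.
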